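(* Let $\psi$ be a weakly T-parallel spinor on $(Q^{n,r},\eta)$, $n\ge3$, with conformal factor $u$ and associated symmetric tensor field $\beta$, such that $\beta$ and $u$ are related to the Ricci tensor and the scalar curvature of $(Q^{n,r},\eta)$ by $$|du|^2\,\beta(X,Y)=\frac{4}{n-2}\Big\{\mathrm{Ric}(X,Y)-\frac12S\,\eta(X,Y)\Big\}-\frac{2c}{a(n-2)}\eta(X,Y)+2\,\eta(X,\nabla_Y(du))+du(X)\,du(Y)+\Big\{\frac{n-1}{2}|du|^2+2\,\triangle u\Big\}\eta(X,Y),$$ for all vector fields $X,Y$, where $a,c\in\mathbb{R}$, $a\neq0$, are real numbers. Then $\psi$ is a solution of the CL-Einstein-Dirac equation of type II, $$D^2\psi=f\,\psi,\qquad a\Big\{\mathrm{Ric}-\frac S2\,\eta\Big\}-\frac c2\,\eta=\frac\epsilon4\,T-\frac\epsilon2\,f\,\eta,$$ $$T(X,Y)=\sigma\Big(X\cdot\nabla_Y(D\psi)+Y\cdot\nabla_X(D\psi),\ \psi\Big)+\sigma(-1)^r\Big(X\cdot\nabla_Y\psi+Y\cdot\nabla_X\psi,\ D\psi\Big),$$ where the characteristic function $f$ is $$f=\frac{(n-1)^2}{16}|du|^2+\frac{n-1}{4}\triangle u$$ and the parameter $\epsilon$ is chosen as $$\epsilon=\frac{4a(n-2)}{n-1}.$$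
   Context: All objects are smooth. $(Q^{n,r},\eta)$ is a connected $n$-dimensional pseudo-Riemannian manifold, where the index $r$ is the number of negative eigenvalues of $\eta$; it is space- and time-oriented with a fixed spin structure. $\nabla$ denotes the Levi-Civita connection and the induced spinor derivative, $D$ the Dirac operator, $\mathrm{Ric}$ and $S$ the Ricci tensor and scalar curvature. The dot is Clifford multiplication, with $X\cdot Y+Y\cdot X=-2\eta(X,Y)$. $\langle\cdot,\cdot\rangle$ is the standard $\mathrm{Spin}^+(n,r)$-equivariant nondegenerate complex (Hermitian) product on the spinor bundle, satisfying $\langle X\cdot\varphi,\psi\rangle+(-1)^r\langle\varphi,X\cdot\psi\rangle=0$, and $(\cdot,\cdot)=\mathrm{Re}\langle\cdot,\cdot\rangle$. A spinor field $\psi$ has constant length $|\psi|=\pm1$ if $(\psi,\psi)=\sigma$ is constantly $\sigma=1$ or constantly $\sigma=-1$. Via $\eta$ the 1-form $du$ is identified with $\mathrm{grad}(u)$, $|du|^2=\eta(\mathrm{grad}\,u,\mathrm{grad}\,u)$, $\triangle:=-\mathrm{div}\circ\mathrm{grad}$, and a $(1,1)$-tensor field $\beta$ is identified with $\beta(X,Y)=\eta(X,\beta(Y))$. Weakly T-parallel spinor: a non-trivial spinor field $\psi$ on $(Q^{n,r},\eta)$, $n\ge3$, is a weakly T-parallel spinor with conformal factor $u$ if it is of constant length $|\psi|=\pm1$ and $$\nabla_X\psi=-\frac14du(X)\psi-\frac14\beta(X)\cdot\mathrm{grad}(u)\cdot\psi$$ for all vector fields $X$, for a symmetric $(1,1)$-tensor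 field $\beta$ with $\mathrm{Tr}(\beta)=n$, and for a function $u:Q^{n,r}\to\mathbb{R}$ such that $|du|$ has no zeros on an open dense subset of $Q^{n,r}$. *)

(* Defs.v *)
From HB Require Import structures.
From mathcomp Require Import all_boot all_order all_algebra.
From mathcomp Require Import complex.
From mathcomp Require Import all_classical all_reals all_analysis.
Set Implicit Arguments.
Unset Strict Implicit.
Unset Printing Implicit Defensive.
Import Order.TTheory GRing.Theory Num.Theory.
Import numFieldNormedType.Exports.
Local Open Scope classical_set_scope.
Local Open Scope complex_scope.
Local Open Scope ring_scope.

Section Calculus.
Variables (R : realType) (n : nat).
Implicit Types (U : set 'rV[R]_n) (x : 'rV[R]_n).

Definition pderiv (m : 'I_n) (f : 'rV[R]_n -> R) (x : 'rV[R]_n) : R :=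
  'D_(delta_mx 0 m) f x.

(** C^oo on the open set [U]: all iterated partial derivatives exist and are
    continuous at every point of [U]. *)
Definition smooth_on U (f : 'rV[R]_n -> R) : Prop :=
  forall (s : seq 'I_n) x, U x ->
    {for x, continuous (foldr pderiv f s)} /\
    forall m, derivable (foldr pderiv f s) x (delta_mx 0 m).

Definition mx_smooth_on U p q (A : 'rV[R]_n -> 'M[R]_(p, q)) : Prop :=
  forall i j, smooth_on U (fun x => A x i j).

Definition cmx_smooth_on U p q (A : 'rV[R]_n -> 'M[R[i]]_(p, q)) : Prop :=
  forall i j, smooth_on U (fun x => complex.Re (A x i j)) /\
              smooth_on U (fun x => complex.Im (A x i j)).

Definition pderiv_cmx (m : 'I_n) p q (A : 'rV[R]_n -> 'M[R[i]]_(p, q)) x :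
    'M[R[i]]_(p, q) :=
  \matrix_(i, j) (pderiv m (fun y => complex.Re (A y i j)) x
                  +i* pderiv m (fun y => complex.Im (A y i j)) x).

End Calculus.

Record manifold (R : realType) (n : nat) := Manifold {
  carrier :> topologicalType;
  chart : Type;
  chart_dom : chart -> set carrier;
  chart_img : chart -> set 'rV[R]_n;
  coord : chart -> carrier -> 'rV[R]_n;
  param : chart -> 'rV[R]_n -> carrier;
  chart_dom_open : forall i, open (chart_dom i);
  chart_img_open : forall i, open (chart_img i);
  chart_cover : forall p, exists i, chart_dom i p;
  coord_img : forall i p, chart_dom i p -> chart_img i (coord i p);
  param_dom : forall i x, chart_img i x -> chart_dom i (param i x);
  coordK : forall i p, chart_dom i p -> param i (coord i p) = p;
  paramK : forall i x, chart_img i x -> coord i (param i x) = x;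
  coord_continuous : forall i, {within chart_dom i, continuous (coord i)};
  param_continuous : forall i, {within chart_img i, continuous (param i)};
  transition_smooth : forall i j,
    mx_smooth_on (chart_img i `&` param i @^-1` chart_dom j)
                 (fun x => coord j (param i x));
  carrier_hausdorff : hausdorff_space carrier;
  carrier_second_countable : @second_countable carrier;
  carrier_connected : connected [set: carrier]
}.

Section Manifold.
Variables (R : realType) (n : nat) (M : manifold R n).
Implicit Types (i j : chart M) (x : 'rV[R]_n).

Definition overlap i j : set 'rV[R]_n :=
  chart_img i `&` param i @^-1` chart_dom j.

Definition transition i j : 'rV[R]_n -> 'rV[R]_n :=
  fun x => coord j (param i x).

Definition smooth_fun (u : M -> R) : Prop :=
  forall i, smooth_on (chart_img i) (u \o param i).

(** Tangent vectors are written as row vectors [v] of components in a chart;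
    the change of chart from [i] to [j] at [x] maps [v] to
    [v *m 'J (transition i j) x]. Tensor fields are families of local
    expressions, one in each chart; only their values on [chart_img i] matter.

    The index is the number of negative eigenvalues, with multiplicity, of the
    Gram matrix of the metric. *)
Record metric (r : nat) := Metric {
  gram :> chart M -> 'rV[R]_n -> 'M[R]_n;
  gram_smooth : forall i, mx_smooth_on (chart_img i) (gram i);
  gram_sym : forall i x, chart_img i x -> (gram i x)^T = gram i x;
  gram_index : forall i x, chart_img i x ->
    exists s : seq R, [/\ char_poly (gram i x) = \prod_(l <- s) ('X - l%:P),
                          0 \notin s & count (fun l => l < 0) s = r];
  gram_transition : forall i j x, overlap i j x ->
    let J := 'J (transition i j) x in
    gram i x = J *m gram j (transition i j x) *m J^T
}.

(** The endomorphism [beta] maps the tangent vector [v] to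
    [v *m endo_rep beta i x]. *)
Record endo_field := EndoField {
  endo_rep :> chart M -> 'rV[R]_n -> 'M[R]_n;
  endo_smooth : forall i, mx_smooth_on (chart_img i) (endo_rep i);
  endo_transition : forall i j x, overlap i j x ->
    let J := 'J (transition i j) x in
    endo_rep i x *m J = J *m endo_rep j (transition i j x)
}.

End Manifold.

Section LocalGeometry.
Variables (R : realType) (n : nat).
Variable g : 'rV[R]_n -> 'M[R]_n.
Implicit Types (v w x : 'rV[R]_n) (X : 'rV[R]_n -> 'rV[R]_n).

Definition ip x v w : R := (v *m g x *m w^T) 0 0.

Definition christoffel (l m k : 'I_n) x : R :=
  2^-1 * \sum_p invmx (g x) l p *
    (pderiv m (fun y => g y p k) x + pderiv k (fun y => g y p m) x
     - pderiv p (fun y => g y m k) x).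

Definition nabla v X x : 'rV[R]_n :=
  \row_l \sum_m v 0 m * (pderiv m (fun y => X y 0 l) x
                         + \sum_k christoffel l m k x * X x 0 k).

(** [R(d_m, d_k) d_s], with
    [R(X, Y) Z = nabla_X nabla_Y Z - nabla_Y nabla_X Z - nabla_[X, Y] Z];
    coordinate fields commute. *)
Definition riemann (m k s : 'I_n) x : 'rV[R]_n :=
  nabla (delta_mx 0 m) (nabla (delta_mx 0 k) (fun=> delta_mx 0 s)) x
  - nabla (delta_mx 0 k) (nabla (delta_mx 0 m) (fun=> delta_mx 0 s)) x.

(** [Ric(Y, Z)] is the trace of [X |-> R(X, Y) Z]. *)
Definition ricci_mx x : 'M[R]_n :=
  \matrix_(k, s) \sum_m riemann m k s x 0 m.

Definition ricci x v w : R := (v *m ricci_mx x *m w^T) 0 0.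

Definition scal x : R := \tr (invmx (g x) *m ricci_mx x).

Definition div X x : R := \sum_m nabla (delta_mx 0 m) X x 0 m.

Variable u : 'rV[R]_n -> R.

Definition differential x : 'rV[R]_n := \row_m pderiv m u x.

Definition du x v : R := (v *m (differential x)^T) 0 0.

Definition grad x : 'rV[R]_n := differential x *m invmx (g x).

Definition normsq_du x : R := ip x (grad x) (grad x).

Definition laplacian x : R := - div grad x.

End LocalGeometry.

Definition sgn (R : realType) (r n : nat) (a : 'I_n) : R := (-1) ^+ (a < r)%N.

Definition hprod (R : realType) N (H : 'M[R[i]]_N) (phi psi : 'cV[R[i]]_N) :
  R[i] := (phi^T *m H *m map_mx (@conjc R) psi) 0 0.

(** A complex representation of the Clifford algebra of R^(n, r) of dimension
    2^(n/2), i.e. an irreducible one, with an invariant Hermitian form. By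
    Schur's lemma these conditions determine the form up to a non-zero real
    factor; together with [gam_skew] they imply Spin^+-invariance. *)
Record spinor_module (R : realType) (n r : nat) := SpinorModule {
  gam : 'I_n -> 'M[R[i]]_(2 ^ n./2);
  herm : 'M[R[i]]_(2 ^ n./2);
  gam_clifford : forall a b, gam a *m gam b + gam b *m gam a =
    (if a == b then - 2 * sgn R r a else 0)%:C%:M;
  herm_hermitian : forall phi psi,
    hprod herm phi psi = conjc (hprod herm psi phi);
  herm_nondegenerate : herm \in unitmx;
  gam_skew : forall a phi psi,
    hprod herm (gam a *m phi) psi + (-1) ^+ r * hprod herm phi (gam a *m psi)
    = 0
}.

Section SpinGeometry.
Variables (R : realType) (n r : nat) (S : spinor_module R n r).
Local Notation N := (2 ^ n./2)%N.
Implicit Types (v x : 'rV[R]_n) (phi : 'rV[R]_n -> 'cV[R[i]]_N).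

Definition rprod (phi psi : 'cV[R[i]]_N) : R :=
  complex.Re (hprod (herm S) phi psi).

Definition clifford v : 'M[R[i]]_N := \sum_a (v 0 a)%:C *: gam S a.

Definition std_normsq v : R := \sum_a sgn R r a * v 0 a ^+ 2.

(** Spin^+(n, r), acting on the spinor module: products of an even number of
    spacelike and an even number of timelike unit vectors. The representation
    is faithful on the spin group. *)
Definition spin_plus : set 'M[R[i]]_N :=
  [set h | exists s : seq 'rV[R]_n,
     [/\ all (fun v => (std_normsq v == 1) || (std_normsq v == -1)) s,
         ~~ odd (count (fun v => std_normsq v == 1) s),
         ~~ odd (count (fun v => std_normsq v == -1) s) &
         h = \big[mulmx/1%:M]_(v <- s) clifford v]].

(** Clifford multiplication by the tangent vector [v], where the rows of [E]
    are the vectors of an orthonormal frame. *)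
Definition cmul (E : 'M[R]_n) v : 'M[R[i]]_N := clifford (v *m invmx E).

Section Local.
Variables (g E : 'rV[R]_n -> 'M[R]_n).

(** Levi-Civita spinor derivative, in the trivialization given by [E]:
    [v(phi) + 1/2 sum_(a < b) eps_a eps_b g(nabla_v e_a, e_b) e_a.e_b.phi]. *)
Definition spin_nabla v phi x : 'cV[R[i]]_N :=
  \sum_m (v 0 m)%:C *: pderiv_cmx m phi x +
  \sum_(a < n) \sum_(b < n | (a < b)%N)
    (2^-1 * sgn R r a * sgn R r b *
     ip g x (nabla g v (fun y => row a (E y)) x) (row b (E x)))%:C
    *: (gam S a *m gam S b *m phi x).

Definition dirac phi x : 'cV[R[i]]_N :=
  \sum_a (sgn R r a)%:C *: (gam S a *m spin_nabla (row a (E x)) phi x).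

Definition energy_momentum_II (sigma : R) phi x v w : R :=
  let c := cmul (E x) in
  sigma * rprod (c v *m spin_nabla w (dirac phi) x +
                 c w *m spin_nabla v (dirac phi) x) (phi x) +
  sigma * (-1) ^+ r * rprod (c v *m spin_nabla w phi x +
                             c w *m spin_nabla v phi x) (dirac phi x).

End Local.
End SpinGeometry.

(** A space and time orientation and a spin structure, presented by
    orthonormal frames [e_i] over the chart domains, with transition functions
    [h_ij] in Spin^+ covering the changes of frame: on overlaps,
    [h_ij (v.) = (v.) h_ij], where the left Clifford multiplication is taken in
    the frame [e_i] and the right one in [e_j]. The frames thus differ by
    elements of SO^+. Every spin structure has this form after refining the
    atlas to charts with, say, contractible domains. *)
Record spin_structure (R : realType) (n r : nat) (M : manifold R n)
    (eta : metric M r) (S : spinor_module R n r) := SpinStructure {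
  frame : chart M -> 'rV[R]_n -> 'M[R]_n;
  frame_smooth : forall i, mx_smooth_on (chart_img i) (frame i);
  frame_orthonormal : forall i x, chart_img i x ->
    frame i x *m eta i x *m (frame i x)^T = diag_mx (\row_a sgn R r a);
  lift : chart M -> chart M -> 'rV[R]_n -> 'M[R[i]]_(2 ^ n./2);
  lift_spin : forall i j x, overlap i j x -> spin_plus S (lift i j x);
  lift_smooth : forall i j, cmx_smooth_on (overlap i j) (lift i j);
  lift_frame : forall i j x v, overlap i j x ->
    lift i j x *m cmul S (frame i x) v =
    cmul S (frame j (transition i j x)) (v *m 'J (transition i j) x)
      *m lift i j x;
  lift_cocycle : forall i j k x, overlap i j x -> overlap i k x ->
    lift j k (transition i j x) *m lift i j x = lift i k x
}.

Record spinor_field (R : realType) (n r : nat) (M : manifold R n)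
    (eta : metric M r) (S : spinor_module R n r)
    (Sp : spin_structure eta S) := SpinorField {
  spinor_rep :> chart M -> 'rV[R]_n -> 'cV[R[i]]_(2 ^ n./2);
  spinor_smooth : forall i, cmx_smooth_on (chart_img i) (spinor_rep i);
  spinor_transition : forall i j x, overlap i j x ->
    spinor_rep j (transition i j x) = lift Sp i j x *m spinor_rep i x
}.

Section Equations.
Variables (R : realType) (n r : nat) (M : manifold R n) (eta : metric M r).
Variables (S : spinor_module R n r) (Sp : spin_structure eta S).
Variable psi : spinor_field Sp.
Implicit Types (i : chart M) (x X Y : 'rV[R]_n).

Definition nontrivial_spinor : Prop :=
  exists i x, chart_img i x /\ psi i x != 0.

Definition has_constant_length (sigma : R) : Prop :=
  (sigma = 1 \/ sigma = -1) /\
  forall i x, chart_img i x -> rprod S (psi i x) (psi i x) = sigma.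

Definition symmetric_endo (beta : endo_field M) : Prop :=
  forall i x X Y, chart_img i x ->
    ip (eta i) x X (Y *m beta i x) = ip (eta i) x (X *m beta i x) Y.

Definition normsq_du_nonzero_on_dense (u : M -> R) : Prop :=
  exists W : set M, [/\ open W, dense W &
    forall i x, chart_img i x -> W (param i x) ->
      normsq_du (eta i) (u \o param i) x != 0].

(** [nabla_X psi] and [beta(X)] depend on [X] pointwise, so the equation is
    required for all tangent vectors [X] instead of all vector fields. *)
Definition weakly_T_parallel (u : M -> R) (beta : endo_field M) (sigma : R) :
    Prop :=
  [/\ nontrivial_spinor, has_constant_length sigma,
      smooth_fun u /\ normsq_du_nonzero_on_dense u,
      symmetric_endo beta /\
        (forall i x, chart_img i x -> \tr (beta i x) = n%:R) &
      forall i x X, chart_img i x ->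
        let ui := u \o param i in
        let c := cmul S (frame Sp i x) in
        spin_nabla S (eta i) (frame Sp i) X (psi i) x =
        - (4^-1 * du ui x X)%:C *: psi i x
        - (4^-1)%:C *: (c (X *m beta i x) *m c (grad (eta i) ui x) *m psi i x)].

(** [f i] is the expression of the characteristic function in the chart [i]. *)
Definition CL_Einstein_Dirac_II (a c epsilon sigma : R)
    (f : chart M -> 'rV[R]_n -> R) : Prop :=
  forall i x, chart_img i x ->
    let g := eta i in
    let E := frame Sp i in
    dirac S g E (dirac S g E (psi i)) x = (f i x)%:C *: psi i x /\
    forall X Y,
      a * (ricci g x X Y - scal g x / 2 * ip g x X Y) - c / 2 * ip g x X Y =
      epsilon / 4 * energy_momentum_II S g E sigma (psi i) x X Y
      - epsilon / 2 * f i x * ip g x X Y.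

End Equations.

(* Main.v *)
Require Import Defs.
From HB Require Import structures.
From mathcomp Require Import all_boot all_order all_algebra.
From mathcomp Require Import complex.
From mathcomp Require Import all_classical all_reals all_analysis.
From mathcomp Require Import ring lra.
Import Order.TTheory GRing.Theory Num.Theory.
Import numFieldNormedType.Exports.
Local Open Scope ring_scope.
Set Implicit Arguments.
Unset Strict Implicit.
Unset Printing Implicit Defensive.

(** The statement is local, so the proof works in one chart, with the metric
    [g], the orthonormal frame [E] and the spinor [psi] given by functions on
    an open set of R^n. Write V = grad u and k = (n - 1) / 4.

    The sum over an orthonormal frame of eps_a e_a.A(e_a) is - Tr A when [A] is
    self-adjoint ([cmul_trace]). With A = beta, of trace n, the equation for
    [psi] gives D psi = k V.psi ([dirac_psi]).

    Since |psi| is constant, (nabla_X psi, psi) = 0. Only the symmetric part of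
    Clifford products pairs nontrivially with [psi] in (X.Y.psi, psi), which
    equals - eta(X, Y) sigma, so the equation for [psi] turns this into
    eta(beta X, V) = du(X), that is beta V = V ([b_grad]). Hence
    nabla_V psi = 0 ([nabla_grad_psi]).

    Differentiating D psi = k V.psi by the Leibniz rule of the spinor
    connection ([spin_nabla_cmul]) gives
    nabla_X (D psi) = k (nabla_X V.psi + V.nabla_X psi). Applying Clifford
    multiplication and summing, the first term contributes k (Delta u) psi,
    because the Hessian of u is self-adjoint and [cmul_trace] applies again; in
    the second one V is moved to the front, at the price of
    - 2 k nabla_V psi = 0, and leaves - k V.D psi = k^2 |du|^2 psi. This is the
    equation D^2 psi = f psi ([dirac_sqr]). Inserting both derivatives in the
    energy-momentum tensor and evaluating the products of up to four vectors
    against [psi] gives ([energy_momentum_psi])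

      T = k (|du|^2 beta - 2 Hess u - du du).

    The hypothesis on the Ricci tensor says exactly that this is the tensor of
    the Einstein equation.

    Two ingredients come from calculus: mixed second partial derivatives
    commute ([derive_commute]), hence the Hessian is symmetric ([hess_sym]);
    and the Levi-Civita connection is metric ([conn_metric]), hence its matrix
    in an orthonormal frame is skew ([omega_skew]) and acts on Clifford
    multiplication as a derivation ([spin_conn_clifford]). *)

(** * Mixed partial derivatives *)

Section Schwarz.
Local Open Scope classical_set_scope.
Variables (R : realType) (V : normedModType R).
Implicit Types (f : V -> R) (x v w : V).

Lemma is_derive_line f x v (s : R) :
  derivable f (x + s *: v) v ->
  is_derive s 1 (fun t : R => f (x + t *: v)) ('D_v f (x + s *: v)).
Proof.
move=> df.
have E : (fun h : R => h^-1 *: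
       (((fun t : R => f (x + t *: v)) \o shift s) (h *: 1) - f (x + s *: v)))
     = (fun h : R => h^-1 *:
       ((f \o shift (x + s *: v)) (h *: v) - f (x + s *: v))).
  apply/funext => h /=; congr (_ *: (f _ - _)).
  by rewrite [h *: 1]mulr1 scalerDl addrCA.
apply: DeriveDef; first by rewrite /derivable E.
by rewrite /derive E.
Qed.

Lemma line_MVT f x v (h : R) : 0 < h ->
  (forall s, 0 <= s <= h -> derivable f (x + s *: v) v) ->
  exists2 s, 0 <= s <= h & f (x + h *: v) - f x = h * 'D_v f (x + s *: v).
Proof.
move=> h0 df.
have dl s : 0 <= s <= h ->
    is_derive s 1 (fun t : R => f (x + t *: v)) ('D_v f (x + s *: v)).
  by move=> /df; exact: is_derive_line.
have [||s sh] := @MVT R (fun t => f (x + t *: v))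
    (fun t => 'D_v f (x + t *: v)) 0 h h0.
- by move=> s; rewrite in_itv/= => /andP[s0 sh]; apply: dl; rewrite !ltW.
- by apply: derivable_within_continuous => s; rewrite in_itv /= => /dl [].
rewrite scale0r addr0 subr0 mulrC => ->.
by exists s => //; move: sh; rewrite in_itv/= => /andP[/ltW-> /ltW->].
Qed.

(** The mean value theorem in the direction [v] is applied to the increment
    [f (y + h *: w) - f y]; its derivative is an increment of ['D_v f], to
    which the mean value theorem in the direction [w] applies. *)
Lemma mixed_MVT f x v w (h : R) : 0 < h ->
  (forall s t, 0 <= s <= h -> 0 <= t <= h ->
     derivable f (x + s *: v + t *: w) v /\
     derivable ('D_v f) (x + s *: v + t *: w) w) ->
  exists s t, [/\ 0 <= s <= h, 0 <= t <= h &
    f (x + h *: v + h *: w) - f (x + h *: v) - (f (x + h *: w) - f x) =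
    h * (h * 'D_w ('D_v f) (x + s *: v + t *: w))].
Proof.
move=> h0 df.
have zh : (0 : R) <= 0 <= h by rewrite lexx ltW.
have hh : 0 <= h <= h by rewrite lexx ltW.
pose F y : R := f (y + h *: w) - f y.
have dF s : 0 <= s <= h -> is_derive (x + s *: v) v F
    ('D_v f (x + s *: v + h *: w) - 'D_v f (x + s *: v)).
  move=> sh; apply: (@is_deriveB _ _ _ (fun y => f (y + h *: w)) f).
    have [d _] := df s h sh hh.
    have E : (fun k : R => k^-1 *: (((fun y => f (y + h *: w))
           \o shift (x + s *: v)) (k *: v) - f (x + s *: v + h *: w)))
        = (fun k : R => k^-1 *: ((f \o shift (x + s *: v + h *: w)) (k *: v)
           - f (x + s *: v + h *: w))).
      by apply/funext => k /=; congr (_ *: (f _ - _)); rewrite -addrA.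
    by apply: DeriveDef; [rewrite /derivable E|rewrite /derive E].
  apply: derivableP; have [d _] := df s 0 sh zh.
  by rewrite scale0r addr0 in d.
have [s sh Fs] := line_MVT h0 (fun s sh => let: DeriveDef d _ := dF s sh in d).
have [t th ft] := line_MVT h0 (fun t th => proj2 (df s t sh th)).
exists s, t; split => //.
have [_] := dF s sh; rewrite ft => Ds.
by rewrite -Ds -Fs /F addrAC.
Qed.

(** The increment of [f] along a small parallelogram is symmetric in the two
    directions, and [mixed_MVT] computes it, up to the same factor, as a value
    near [x] of either mixed derivative. Continuity at [x] concludes. *)
Lemma derive_commute f x v w :
  (\forall y \near x, [/\ derivable f y v, derivable ('D_v f) y w,
     derivable f y w & derivable ('D_w f) y v]) ->
  {for x, continuous ('D_w ('D_v f))} -> {for x, continuous ('D_v ('D_w f))} ->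
  'D_w ('D_v f) x = 'D_v ('D_w f) x.
Proof.
move=> df cwv cvw; apply/eqP; rewrite -subr_eq0 -normr_le0.
apply/ler_addgt0Pr => e e0; rewrite add0r.
have e2 : 0 < e / 2 by rewrite divr_gt0.
have [d /= d0 near_d] : exists2 d, 0 < d & forall y, `|y - x| < d ->
   [/\ derivable f y v, derivable ('D_v f) y w, derivable f y w
     & derivable ('D_w f) y v] /\
   (`|'D_w ('D_v f) x - 'D_w ('D_v f) y| < e / 2 /\
    `|'D_v ('D_w f) x - 'D_v ('D_w f) y| < e / 2).
  move/cvgrPdist_lt: cwv => /(_ _ e2) cwv.
  move/cvgrPdist_lt: cvw => /(_ _ e2) cvw.
  have := filterI df (filterI cwv cvw); rewrite nbhs_ballP => -[d /= d0 H].
  exists d => // y yx; apply: H.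
  by rewrite -ball_normE /= distrC.
(* Parallelograms of side [h] at [x] stay in the ball of radius [d]. *)
pose K := `|v| + `|w| + 1; pose h := d / 2 / K.
have K0 : 0 < K by rewrite ltr_wpDl// addr_ge0.
have h0 : 0 < h by rewrite !divr_gt0.
have small s t : 0 <= s <= h -> 0 <= t <= h ->
    `|x + s *: v + t *: w - x| < d.
  move=> /andP[s0 sh] /andP[t0 th].
  rewrite -[x + _ + _]addrA [x + _]addrC addrK (le_lt_trans (ler_normD _ _))//.
  rewrite !normrZ !ger0_norm// (@le_lt_trans _ _ (h * K))//.
    rewrite /K !mulrDr mulr1 -[leLHS]addr0 lerD ?(ltW h0)//.
    by rewrite lerD ?ler_wpM2r.
  by rewrite /h mulfVK ?gt_eqF// ltr_pdivrMr// ltr_pMr ?ltr1n.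
have small' s t : 0 <= s <= h -> 0 <= t <= h ->
    `|x + s *: w + t *: v - x| < d.
  by move=> sh th; rewrite [x + _ + _]addrAC small.
have [|s [t [sh th]]] := @mixed_MVT f x v w h h0.
  by move=> s t sh th; have [[]] := near_d _ (small _ _ sh th).
have [|s' [t' [sh' th']]] := @mixed_MVT f x w v h h0.
  by move=> s' t' sh' th'; have [[]] := near_d _ (small' _ _ sh' th').
have -> : f (x + h *: w + h *: v) - f (x + h *: w) - (f (x + h *: v) - f x) =
  f (x + h *: v + h *: w) - f (x + h *: v) - (f (x + h *: w) - f x).
  by rewrite [x + _ + _]addrAC; ring.
move=> -> /(mulfI (lt0r_neq0 h0)) /(mulfI (lt0r_neq0 h0)) E.
have [_ [Pw _]] := near_d _ (small _ _ sh th).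
have [_ [_ Pv]] := near_d _ (small' _ _ sh' th').
move: E Pw Pv; move: ('D_w ('D_v f) x) ('D_v ('D_w f) x)
  ('D_w ('D_v f) (_ + _)) ('D_v ('D_w f) (_ + _)) => A B P Q ->.
by rewrite !ltr_norml ler_norml => /andP[? ?] /andP[? ?]; apply/andP; lra.
Qed.

End Schwarz.

(** * Derivatives of real and complex matrix functions *)

Section MatrixCalculus.
Local Open Scope complex_scope.
Variables (R : realType) (n : nat).
Local Notation V := 'rV[R]_n.
Implicit Types (m : 'I_n) (x : V).

(** [D f df] stands for: [f] has derivative [df] at [x]. Only the rules for
    sums and products of scalar functions matter, so one argument serves real
    matrices and complex ones, the latter being differentiated through their
    real and imaginary parts. *)
Lemma mulmx_leibniz (T : Type) (K : pzRingType) (D : (T -> K) -> K -> Prop)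
    (x : T) :
  D (fun=> 0) 0 ->
  (forall f g df dg, D f df -> D g dg -> D (fun y => f y + g y) (df + dg)) ->
  (forall f g df dg, D f df -> D g dg ->
     D (fun y => f y * g y) (df * g x + f x * dg)) ->
  forall p q s (A : T -> 'M[K]_(p, q)) (dA : 'M[K]_(p, q))
    (B : T -> 'M[K]_(q, s)) (dB : 'M[K]_(q, s)),
  (forall i j, D (fun y => A y i j) (dA i j)) ->
  (forall i j, D (fun y => B y i j) (dB i j)) ->
  forall i j, D (fun y => (A y *m B y) i j) ((dA *m B x + A x *m dB) i j).
Proof.
move=> D0 DD DM p q s A dA B dB hA hB i j.
have -> : (fun y => (A y *m B y) i j) = (fun y => \sum_k A y i k * B y k j).
  by apply/funext => y; rewrite mxE.
rewrite !mxE -big_split /=; elim: (index_enum _) => [|k ks IH].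
  by under eq_fun do rewrite big_nil; rewrite big_nil.
under eq_fun do rewrite big_cons; rewrite big_cons.
by apply: DD => //; exact: DM.
Qed.

(** Partial derivatives are handled as relations: the Leibniz rules then
    produce at the same time the existence of a derivative and its value. *)
Definition is_pderiv m (f : V -> R) x (df : R) :=
  is_derive x (delta_mx 0 m) f df.

Definition is_pderiv_mx m p q (A : V -> 'M[R]_(p, q)) x (dA : 'M[R]_(p, q)) :=
  forall i j, is_pderiv m (fun y => A y i j) x (dA i j).

Definition pderiv_mx m p q (A : V -> 'M[R]_(p, q)) x : 'M[R]_(p, q) :=
  \matrix_(i, j) pderiv m (fun y => A y i j) x.

Lemma is_pderiv_val m f x df : is_pderiv m f x df -> pderiv m f x = df.
Proof. by move=> h; apply: derive_val. Qed.

Lemma is_pderiv_mx_val m p q (A : V -> 'M[R]_(p, q)) x dA :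
  is_pderiv_mx m A x dA -> pderiv_mx m A x = dA.
Proof. by move=> h; apply/matrixP => i j; rewrite mxE; apply: is_pderiv_val. Qed.

Lemma is_pderiv_mx_near m p q (A B : V -> 'M[R]_(p, q)) x dA :
  (\forall y \near x, A y = B y) -> is_pderiv_mx m A x dA ->
  is_pderiv_mx m B x dA.
Proof.
move=> AB hA i j; apply: near_eq_is_derive (hA i j).
by near=> y; rewrite (near AB y).
Unshelve. all: by end_near. Qed.

Lemma pderiv_mx_near m p q (A B : V -> 'M[R]_(p, q)) x :
  (\forall y \near x, A y = B y) -> pderiv_mx m A x = pderiv_mx m B x.
Proof.
move=> AB; apply/matrixP => i j; rewrite !mxE /pderiv.
apply: near_eq_derive; by near=> y; rewrite (near AB y).
Unshelve. all: by end_near. Qed.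

Lemma is_pderiv_mx_cst m p q (A : 'M[R]_(p, q)) x : is_pderiv_mx m (fun=> A) x 0.
Proof. by move=> i j; rewrite mxE; apply: is_derive_cst. Qed.

Lemma is_pderiv_mx_tr m p q (A : V -> 'M[R]_(p, q)) x dA :
  is_pderiv_mx m A x dA -> is_pderiv_mx m (fun y => (A y)^T) x dA^T.
Proof.
move=> hA i j; rewrite mxE /is_pderiv.
by under eq_fun do rewrite mxE; exact: hA.
Qed.

Lemma is_pderivM m (f g : V -> R) x df dg :
  is_pderiv m f x df -> is_pderiv m g x dg ->
  is_pderiv m (fun y => f y * g y) x (df * g x + f x * dg).
Proof.
move=> hf hg; rewrite addrC [df * _]mulrC.
exact: (@is_deriveM _ _ f g).
Qed.

Lemma is_pderivD m (f g : V -> R) x df dg :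
  is_pderiv m f x df -> is_pderiv m g x dg ->
  is_pderiv m (fun y => f y + g y) x (df + dg).
Proof. move=> hf hg; exact: (@is_deriveD _ _ _ f g). Qed.

Lemma is_pderivB m (f g : V -> R) x df dg :
  is_pderiv m f x df -> is_pderiv m g x dg ->
  is_pderiv m (fun y => f y - g y) x (df - dg).
Proof. move=> hf hg; exact: (@is_deriveB _ _ _ f g). Qed.

Lemma is_pderiv_cst m (c : R) x : is_pderiv m (fun=> c) x 0.
Proof. exact: is_derive_cst. Qed.

Lemma is_pderiv_mxZ m p q (k : R) (A : V -> 'M[R]_(p, q)) x dA :
  is_pderiv_mx m A x dA -> is_pderiv_mx m (fun y => k *: A y) x (k *: dA).
Proof.
move=> hA i j; rewrite mxE -[k * _]add0r -(mul0r (A x i j)).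
under eq_fun do rewrite mxE.
by apply: is_pderivM; [exact: is_pderiv_cst|exact: hA].
Qed.

Lemma is_pderiv_mulmx m p q s (A : V -> 'M[R]_(p, q)) (B : V -> 'M[R]_(q, s))
    x dA dB :
  is_pderiv_mx m A x dA -> is_pderiv_mx m B x dB ->
  is_pderiv_mx m (fun y => A y *m B y) x (dA *m B x + A x *m dB).
Proof.
apply: (@mulmx_leibniz _ _ (fun f df => is_pderiv m f x df)).
- exact: is_pderiv_cst.
- by move=> *; exact: is_pderivD.
- by move=> *; exact: is_pderivM.
Qed.

Definition is_cpderiv m (f : V -> R[i]) x (df : R[i]) :=
  is_pderiv m (fun y => complex.Re (f y)) x (complex.Re df) /\
  is_pderiv m (fun y => complex.Im (f y)) x (complex.Im df).

Definition is_pderiv_cmx m p q (A : V -> 'M[R[i]]_(p, q)) x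
    (dA : 'M[R[i]]_(p, q)) :=
  forall i j, is_cpderiv m (fun y => A y i j) x (dA i j).

Lemma is_pderiv_cmx_val m p q (A : V -> 'M[R[i]]_(p, q)) x dA :
  is_pderiv_cmx m A x dA -> pderiv_cmx m A x = dA.
Proof.
move=> h; apply/matrixP => i j; rewrite mxE.
have [/is_pderiv_val -> /is_pderiv_val ->] := h i j.
by case: (dA i j).
Qed.

Lemma pderiv_cmx_near m p q (A B : V -> 'M[R[i]]_(p, q)) x :
  (\forall y \near x, A y = B y) -> pderiv_cmx m A x = pderiv_cmx m B x.
Proof.
move=> AB; apply/matrixP => i j; rewrite !mxE /pderiv.
by congr (_ +i* _); apply: near_eq_derive; near=> y; rewrite (near AB y).
Unshelve. all: by end_near. Qed.

Lemma mulr2_inj (W : lmodType R[i]) (A B : W) : A *+ 2 = B *+ 2 -> A = B.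
Proof.
move/eqP; rewrite -subr_eq0 -mulrnBl -scaler_nat scaler_eq0 pnatr_eq0 /=.
by rewrite subr_eq0 => /eqP.
Qed.

Lemma cReM (z w : R[i]) : complex.Re (z * w) =
  complex.Re z * complex.Re w - complex.Im z * complex.Im w.
Proof. by case: z; case: w. Qed.

Lemma cImM (z w : R[i]) : complex.Im (z * w) =
  complex.Re z * complex.Im w + complex.Im z * complex.Re w.
Proof. by case: z; case: w. Qed.

Lemma cReD (z w : R[i]) : complex.Re (z + w) = complex.Re z + complex.Re w.
Proof. by case: z; case: w. Qed.

Lemma cImD (z w : R[i]) : complex.Im (z + w) = complex.Im z + complex.Im w.
Proof. by case: z; case: w. Qed.

Lemma is_cpderivM m (f g : V -> R[i]) x df dg :
  is_cpderiv m f x df -> is_cpderiv m g x dg ->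
  is_cpderiv m (fun y => f y * g y) x (df * g x + f x * dg).
Proof.
move=> [rf jf] [rg jg]; split.
  under eq_fun do rewrite cReM.
  rewrite cReD !cReM addrACA -opprD.
  by apply: is_pderivB; exact: is_pderivM.
under eq_fun do rewrite cImM.
rewrite cImD !cImM addrACA.
by apply: is_pderivD; exact: is_pderivM.
Qed.

Lemma is_cpderivD m (f g : V -> R[i]) x df dg :
  is_cpderiv m f x df -> is_cpderiv m g x dg ->
  is_cpderiv m (fun y => f y + g y) x (df + dg).
Proof.
move=> [rf jf] [rg jg]; split.
  by under eq_fun do rewrite cReD; rewrite cReD; exact: is_pderivD.
by under eq_fun do rewrite cImD; rewrite cImD; exact: is_pderivD.
Qed.

Lemma is_pderiv_cmx_mulmx m p q s (A : V -> 'M[R[i]]_(p, q))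
    (B : V -> 'M[R[i]]_(q, s))
    x dA dB :
  is_pderiv_cmx m A x dA -> is_pderiv_cmx m B x dB ->
  is_pderiv_cmx m (fun y => A y *m B y) x (dA *m B x + A x *m dB).
Proof.
apply: (@mulmx_leibniz _ _ (fun f df => is_cpderiv m f x df)).
- by split; exact: is_pderiv_cst.
- by move=> *; exact: is_cpderivD.
- by move=> *; exact: is_cpderivM.
Qed.

Lemma is_pderiv_cmx_cst m p q (A : 'M[R[i]]_(p, q)) x : is_pderiv_cmx m (fun=> A) x 0.
Proof. by move=> i j; rewrite mxE; split; exact: is_pderiv_cst. Qed.

Lemma is_pderiv_cmx_tr m p q (A : V -> 'M[R[i]]_(p, q)) x dA :
  is_pderiv_cmx m A x dA -> is_pderiv_cmx m (fun y => (A y)^T) x dA^T.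
Proof.
move=> hA i j; rewrite mxE; have [hr hi] := hA j i.
by split; under eq_fun do rewrite mxE.
Qed.

Lemma is_pderiv_cmx_conj m p q (A : V -> 'M[R[i]]_(p, q)) x dA :
  is_pderiv_cmx m A x dA ->
  is_pderiv_cmx m (fun y => map_mx (@conjc R) (A y)) x (map_mx (@conjc R) dA).
Proof.
move=> hA i j; rewrite mxE; have [hr hi] := hA i j; split.
  have -> : (fun y => complex.Re (map_mx (@conjc R) (A y) i j)) =
    (fun y => complex.Re (A y i j)).
    by apply/funext => y; rewrite mxE; case: (A y i j).
  by have -> : complex.Re (conjc (dA i j)) = complex.Re (dA i j)
    by case: (dA i j).
have -> : (fun y => complex.Im (map_mx (@conjc R) (A y) i j)) =
    (fun y => 0 - complex.Im (A y i j)).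
  by apply/funext => y; rewrite mxE sub0r; case: (A y i j).
have -> : complex.Im (conjc (dA i j)) = 0 - complex.Im (dA i j).
  by rewrite sub0r; case: (dA i j).
by apply: is_pderivB => //; exact: is_pderiv_cst.
Qed.

Lemma is_pderiv_cmx_real m p q (A : V -> 'M[R]_(p, q)) x dA :
  is_pderiv_mx m A x dA ->
  is_pderiv_cmx m (fun y => map_mx (real_complex R) (A y)) x
    (map_mx (real_complex R) dA).
Proof.
move=> hA i j; rewrite mxE; split => /=.
  by under eq_fun do rewrite mxE /=; exact: hA.
by under eq_fun do rewrite mxE /=; exact: is_pderiv_cst.
Qed.

Lemma smooth_is_pderiv U (f : V -> R) m x :
  smooth_on U f -> U x -> is_pderiv m f x (pderiv m f x).
Proof. by move=> sf Ux; apply: derivableP; have [_] := sf [::] x Ux; apply. Qed.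

Lemma smooth_is_pderiv_mx U p q (A : V -> 'M[R]_(p, q)) m x :
  mx_smooth_on U A -> U x -> is_pderiv_mx m A x (pderiv_mx m A x).
Proof. by move=> sA Ux i j; rewrite mxE; apply: smooth_is_pderiv Ux. Qed.

Lemma smooth_is_pderiv_cmx U p q (A : V -> 'M[R[i]]_(p, q)) m x :
  cmx_smooth_on U A -> U x -> is_pderiv_cmx m A x (pderiv_cmx m A x).
Proof.
by move=> sA Ux i j; rewrite mxE; have [? ?] := sA i j; split;
  apply: smooth_is_pderiv Ux.
Qed.

Lemma smooth_pderivC U (f : V -> R) m k x :
  open U -> smooth_on U f -> U x ->
  pderiv m (pderiv k f) x = pderiv k (pderiv m f) x.
Proof.
move=> oU sf Ux; apply: derive_commute.
- near=> y.
  have Uy : U y by near: y; exact: open_nbhs_nbhs.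
  by split; [have [_] := sf [::] y Uy|have [_] := sf [:: k] y Uy|
    have [_] := sf [::] y Uy|have [_] := sf [:: m] y Uy]; apply.
- by have [] := sf [:: m; k] x Ux.
- by have [] := sf [:: k; m] x Ux.
Unshelve. all: by end_near. Qed.

End MatrixCalculus.

(** * The Levi-Civita connection and the Hessian *)

Section LeviCivita.
Local Open Scope classical_set_scope.
Variables (R : realType) (n : nat).
Local Notation V := 'rV[R]_n.
Variables (U : set V) (g : V -> 'M[R]_n).
Hypotheses (oU : open U) (g_smooth : mx_smooth_on U g).
Hypothesis g_sym : forall x, U x -> (g x)^T = g x.
Hypothesis g_unit : forall x, U x -> g x \in unitmx.
Implicit Types (m : 'I_n) (x v w : V).

Lemma near_open x (P : V -> Prop) :
  U x -> (forall y, U y -> P y) -> \forall y \near x, P y.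
Proof.
move=> Ux UP; near=> y; apply: UP.
by near: y; exact: open_nbhs_nbhs.
Unshelve. all: by end_near. Qed.

(** Matrix of the connection in the direction of the [m]-th coordinate,
    arranged to act on row vectors. *)
Definition conn m x : 'M[R]_n := \matrix_(k, l) christoffel g l m k x.

Lemma nablaE v (X : V -> V) x :
  nabla g v X x = \sum_m v 0 m *: (pderiv_mx m X x + X x *m conn m x).
Proof.
apply/rowP => l; rewrite mxE summxE; apply: eq_bigr => m _.
rewrite !mxE; congr (_ * (_ + _)); apply: eq_bigr => k _.
by rewrite mxE mulrC.
Qed.

Lemma nablaZ v (k : R) (X : V -> V) x :
  (forall m, is_pderiv_mx m X x (pderiv_mx m X x)) ->
  nabla g v (fun y => k *: X y) x = k *: nabla g v X x.
Proof.
move=> hX; rewrite !nablaE scaler_sumr; apply: eq_bigr => m _.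
rewrite scalerA mulrC -scalerA; congr (_ *: _); rewrite scalerDr; congr (_ + _).
  exact: is_pderiv_mx_val (is_pderiv_mxZ k (hX m)).
by rewrite -scalemxAl.
Qed.

Lemma pderiv_g_sym m x : U x -> (pderiv_mx m g x)^T = pderiv_mx m g x.
Proof.
move=> Ux; have h := smooth_is_pderiv_mx m g_smooth Ux.
rewrite -(is_pderiv_mx_val (is_pderiv_mx_tr h)); apply: pderiv_mx_near.
exact: near_open.
Qed.

(** The connection is torsion-free. *)
Lemma conn_sym m k l x : U x -> conn m x k l = conn k x m l.
Proof.
move=> Ux; rewrite !mxE /christoffel; congr (_ * _); apply: eq_bigr => p _.
congr (_ * _); have /matrixP/(_ k m) := pderiv_g_sym p Ux.
by rewrite !mxE => ->; rewrite [pderiv m _ _ + _]addrC.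
Qed.

(** The index of the Christoffel symbols is lowered with [g]: this removes the
    inverse matrix and leaves the first kind of symbols, for which metricity is
    a cancellation. *)
Lemma conn_lower m k q x : U x -> (conn m x *m g x) k q =
  2^-1 * (pderiv_mx m g x q k + pderiv_mx k g x q m - pderiv_mx q g x m k).
Proof.
move=> Ux; pose K := \row_p
  (pderiv_mx m g x p k + pderiv_mx k g x p m - pderiv_mx p g x m k).
have invg_sym l p : invmx (g x) l p = invmx (g x) p l.
  by have /matrixP/(_ p l) := trmx_inv (g x); rewrite mxE g_sym.
have E : row k (conn m x) = 2^-1 *: (K *m invmx (g x)).
  apply/rowP => l; rewrite [LHS]mxE [LHS]mxE [RHS]mxE [X in _ = _ * X]mxE.
  congr (_ * _); apply: eq_bigr => p _.
  by rewrite invg_sym mulrC; congr (_ * _); rewrite !mxE.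
transitivity (row k (conn m x *m g x) 0 q); first by rewrite [RHS]mxE.
by rewrite row_mul E -scalemxAl mulmxKV ?g_unit// [LHS]mxE [X in _ * X]mxE.
Qed.

(** The Levi-Civita connection is metric. *)
Lemma conn_metric m x : U x ->
  pderiv_mx m g x = conn m x *m g x + g x *m (conn m x)^T.
Proof.
move=> Ux; apply/matrixP => k q.
have -> : g x *m (conn m x)^T = (conn m x *m g x)^T by rewrite trmx_mul g_sym.
rewrite [RHS]mxE [X in _ = _ + X]mxE !conn_lower//.
have sy p i j : pderiv_mx p g x i j = pderiv_mx p g x j i.
  by rewrite -{1}(pderiv_g_sym p Ux) mxE.
have cancel (a a' b b' c c' : R) : a = a' -> b = b' -> c = c' ->
    a = 2^-1 * (a' + b - c) + 2^-1 * (a + c' - b').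
  by move=> -> -> ->; field.
exact: cancel (sy m k q) (sy k q m) (sy q m k).
Qed.

Lemma ip_sym x v w : U x -> ip g x v w = ip g x w v.
Proof.
move=> Ux; rewrite /ip; transitivity ((v *m g x *m w^T)^T 0 0).
  by rewrite [RHS]mxE.
by rewrite !trmx_mul trmxK g_sym// mulmxA.
Qed.

Lemma mx_delta_entry (A : 'M[R]_n) (i j : 'I_n) :
  (delta_mx 0 i *m A *m (delta_mx 0 j)^T : 'M[R]_1) 0 0 = A i j.
Proof. by rewrite -rowE trmx_delta -colE mxE mxE. Qed.

Lemma ip_inj x v w : U x -> (forall z, ip g x z v = ip g x z w) -> v = w.
Proof.
move=> Ux h; apply: trmx_inj; apply: (can_inj (mulKmx (g_unit Ux))).
apply/matrixP => i j; rewrite (ord1 j).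
have := h (delta_mx 0 i); rewrite /ip -!mulmxA -!rowE.
by rewrite [LHS]mxE [RHS]mxE.
Qed.

Lemma ip_selfadjoint x (A : 'M[R]_n) : U x ->
  (forall v w, ip g x v (w *m A) = ip g x (v *m A) w) ->
  (A *m g x)^T = A *m g x.
Proof.
move=> Ux h; rewrite trmx_mul g_sym//; apply/matrixP => i j.
have := h (delta_mx 0 i) (delta_mx 0 j).
rewrite /ip trmx_mul !mulmxA -[_ *m g x *m _]mulmxA.
by rewrite -[_ *m A *m _]mulmxA !mx_delta_entry.
Qed.

Lemma ip_mulmx_sym x (A : 'M[R]_n) v w : U x -> (A *m g x)^T = A *m g x ->
  ip g x v (w *m A) = ip g x w (v *m A).
Proof.
move=> Ux symA; rewrite [RHS]ip_sym// /ip -[v *m A *m _]mulmxA -symA.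
by rewrite !trmx_mul g_sym// !mulmxA.
Qed.

Section Hessian.
Variable u : V -> R.
Hypothesis u_smooth : smooth_on U u.
Hypothesis grad_derivable : forall m x, U x ->
  is_pderiv_mx m (grad g u) x (pderiv_mx m (grad g u) x).

(** Matrix of the endomorphism [v |-> nabla_v (grad u)] acting on row
    vectors. *)
Definition hess x : 'M[R]_n :=
  \matrix_(m, l) (pderiv_mx m (grad g u) x + grad g u x *m conn m x) 0 l.

Lemma nabla_gradE v x : nabla g v (grad g u) x = v *m hess x.
Proof.
rewrite nablaE; apply/rowP => l; rewrite summxE mxE; apply: eq_bigr => m _.
by rewrite [LHS]mxE [in RHS]mxE.
Qed.

Lemma laplacianE x : laplacian g u x = - \tr (hess x).
Proof.
rewrite /laplacian /div /mxtrace; congr (- _); apply: eq_bigr => m _.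
by rewrite nabla_gradE -rowE mxE.
Qed.

Lemma grad_mulg x : U x -> grad g u x *m g x = differential u x.
Proof. by move=> Ux; rewrite /grad mulmxKV ?g_unit. Qed.

Lemma ip_grad x v : U x -> ip g x v (grad g u x) = du u x v.
Proof.
move=> Ux; rewrite /ip /du -mulmxA; congr ((_ *m _) 0 0).
by rewrite -{1}(g_sym Ux) -trmx_mul grad_mulg.
Qed.

Lemma pderiv_differential m x : U x -> is_pderiv_mx m (differential u) x
  (\row_k pderiv m (pderiv k u) x).
Proof.
move=> Ux i k; rewrite mxE /is_pderiv.
under eq_fun do rewrite mxE.
by apply: derivableP; have [_] := u_smooth [:: k] Ux; apply.
Qed.

(** Metricity of the connection turns the derivative of [grad u] into that of
    [du] once the index is lowered; the right-hand side is the usual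
    coordinate expression of the Hessian. *)
Lemma hess_mulg x : U x -> hess x *m g x =
  \matrix_(m, k) (pderiv m (pderiv k u) x
                  - (differential u x *m (conn m x)^T) 0 k).
Proof.
move=> Ux; apply/row_matrixP => m; rewrite row_mul.
have -> : row m (hess x) = pderiv_mx m (grad g u) x + grad g u x *m conn m x.
  by apply/rowP => l; rewrite !mxE.
have := is_pderiv_mx_val (is_pderiv_mx_near (near_open Ux grad_mulg)
  (is_pderiv_mulmx (grad_derivable m Ux) (smooth_is_pderiv_mx m g_smooth Ux))).
rewrite (is_pderiv_mx_val (pderiv_differential m Ux)) conn_metric// mulmxDr.
rewrite [grad _ _ _ *m (g x *m _)]mulmxA grad_mulg// addrA mulmxA -mulmxDl.
by move=> h; apply/rowP => k; move/rowP/(_ k): h; rewrite !mxE => ->; rewrite addrK.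
Qed.

Lemma hess_sym x : U x -> (hess x *m g x)^T = hess x *m g x.
Proof.
move=> Ux; rewrite hess_mulg//; apply/matrixP => m k; rewrite !mxE.
rewrite (smooth_pderivC m k oU u_smooth Ux); congr (_ - _).
by apply: eq_bigr => l _; rewrite ![_^T _ _]mxE conn_sym.
Qed.

End Hessian.
End LeviCivita.


(** * Clifford algebra and the spin connection *)

Section Clifford.
Local Open Scope complex_scope.
Variables (R : realType) (n r : nat) (S : spinor_module R n r).
Local Notation N := (2 ^ n./2)%N.
Local Notation V := 'rV[R]_n.
Implicit Types (w : V) (phi psi : 'cV[R[i]]_N).

Definition sgnmx : 'M[R]_n := diag_mx (\row_a sgn R r a).

Lemma sgn_sqr (a : 'I_n) : sgn R r a * sgn R r a = 1.
Proof. by rewrite /sgn -expr2 sqrr_sign. Qed.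

Lemma sgnmxK : sgnmx *m sgnmx = 1%:M.
Proof.
rewrite /sgnmx mulmx_diag -diag_const_mx; congr diag_mx.
by apply/rowP => a; rewrite !mxE sgn_sqr.
Qed.

Lemma mulmx_sgnmx p (A : 'M[R]_(p, n)) i j : (A *m sgnmx) i j = A i j * sgn R r j.
Proof. by rewrite mul_mx_diag !mxE. Qed.

Lemma cliffordD v w : clifford S (v + w) = clifford S v + clifford S w.
Proof.
rewrite /clifford -big_split /=; apply: eq_bigr => a _.
by rewrite mxE rmorphD scalerDl.
Qed.

Lemma cliffordZ (k : R) w : clifford S (k *: w) = k%:C *: clifford S w.
Proof.
rewrite /clifford scaler_sumr; apply: eq_bigr => a _.
by rewrite mxE rmorphM scalerA.
Qed.

Lemma clifford_sum (I : Type) (s : seq I) (P : pred I) (F : I -> V) :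
  clifford S (\sum_(i <- s | P i) F i) = \sum_(i <- s | P i) clifford S (F i).
Proof.
apply: (big_morph _ cliffordD).
by rewrite -[0](scale0r (0 : V)) cliffordZ rmorph0 scale0r.
Qed.

Lemma clifford_delta (a : 'I_n) : clifford S (delta_mx 0 a) = gam S a.
Proof.
rewrite /clifford (bigD1 a)//= big1 => [|b /negPf ab].
  by rewrite mxE !eqxx scale1r addr0.
by rewrite mxE ab andbF scale0r.
Qed.

Lemma gam_anti (a b : 'I_n) : a != b -> gam S a *m gam S b = - (gam S b *m gam S a).
Proof.
move=> /negPf ab; have := gam_clifford S a b; rewrite ab => /eqP.
by rewrite raddf0 addr_eq0 => /eqP.
Qed.

(** By symmetry of the coefficients the double sum only involves the
    anticommutators of the generators, and these vanish off the diagonal. *)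
Lemma clifford_trace (B : 'M[R]_n) : (B *m sgnmx)^T = B *m sgnmx ->
  \sum_a (sgn R r a)%:C *: (gam S a *m clifford S (row a B)) = - (\tr B)%:C%:M.
Proof.
move=> symB; pose c a b := sgn R r a * B a b.
have csym a b : c a b = c b a.
  have /matrixP/(_ a b) := symB; rewrite mxE !mulmx_sgnmx /c => h.
  apply: (mulIf (x := sgn R r b)); first by rewrite signr_eq0.
  rewrite -mulrA -h mulrA mulrAC -expr2 sqrr_sign mul1r.
  by rewrite mulrAC -expr2 sqrr_sign mul1r.
pose s := \sum_a \sum_b (c a b)%:C *: (gam S a *m gam S b).
have -> : \sum_a (sgn R r a)%:C *: (gam S a *m clifford S (row a B)) = s.
  apply: eq_bigr => a _; rewrite /clifford mulmx_sumr scaler_sumr.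
  by apply: eq_bigr => b _; rewrite -scalemxAr scalerA -rmorphM mxE.
have s2 : s + s = \sum_a (- 2 * B a a)%:C%:M.
  rewrite /s {2}exchange_big -big_split /=; apply: eq_bigr => a _.
  rewrite -big_split /= (bigD1 a)//= big1 => [|b ab].
    rewrite addr0 -scalerDr gam_clifford eqxx.
    have -> : - 2 * B a a = c a a * (- 2 * sgn R r a).
      transitivity (sgn R r a * sgn R r a * (- 2 * B a a)).
        by rewrite sgn_sqr mul1r.
      by rewrite /c; ring.
    by rewrite scale_scalar_mx -rmorphM.
  by rewrite csym -scalerDr gam_clifford eq_sym (negPf ab) raddf0 scaler0.
apply: mulr2_inj.
have -> : s *+ 2 = (- (\tr B *+ 2))%:C%:M.
  rewrite [s *+ 2]mulr2n s2 -[\tr B *+ 2]mulr_natl -mulNr.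
  by rewrite /mxtrace mulr_sumr !raddf_sum.
by rewrite !raddfN /= !raddfMn.
Qed.

End Clifford.

Section SpinConnection.
Local Open Scope complex_scope.
Local Open Scope classical_set_scope.
Variables (R : realType) (n r : nat) (S : spinor_module R n r).
Local Notation N := (2 ^ n./2)%N.
Local Notation V := 'rV[R]_n.
Implicit Types (m : 'I_n) (x v w : V).

Lemma invmx_right (p : nat) (A B : 'M[R]_p) :
  A *m B = 1%:M -> A \in unitmx /\ invmx A = B.
Proof.
move=> AB; have [uA _] := mulmx1_unit AB; split => //.
by rewrite -[LHS]mulmx1 -AB mulKmx.
Qed.

(** The Clifford element of the skew matrix [w], with the same sum over a < b
    as in the spinor derivative. *)
Definition spin_conn (w : 'M[R]_n) : 'M[R[i]]_N :=
  \sum_(a < n) \sum_(b < n | (a < b)%N)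
    (2^-1 * sgn R r a * sgn R r b * w a b)%:C *: (gam S a *m gam S b).

Lemma spin_conn_sum (I : Type) (s : seq I) (c : I -> R) (F : I -> 'M[R]_n) :
  spin_conn (\sum_(i <- s) c i *: F i) = \sum_(i <- s) (c i)%:C *: spin_conn (F i).
Proof.
rewrite /spin_conn; under [RHS]eq_bigr do rewrite scaler_sumr.
rewrite [RHS]exchange_big; apply: eq_bigr => a _ /=.
under [RHS]eq_bigr do rewrite scaler_sumr.
rewrite [RHS]exchange_big; apply: eq_bigr => b _ /=.
under [RHS]eq_bigr do rewrite scalerA -rmorphM.
rewrite -scaler_suml; congr (_ *: _).
rewrite -raddf_sum summxE mulr_sumr; congr (_%:C); apply: eq_bigr => i _.
by rewrite mxE; ring.
Qed.

Lemma sum_lt_sym (W : zmodType) (F : 'I_n -> 'I_n -> W) :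
  (forall a b, F a b = F b a) -> (forall a, F a a = 0) ->
  \sum_a \sum_b F a b = (\sum_(a < n) \sum_(b < n | (a < b)%N) F a b) *+ 2.
Proof.
move=> Fs F0; transitivity (\sum_(a < n) \sum_(b < n | (a < b)%N) F a b +
    \sum_(a < n) \sum_(b < n | (b < a)%N) F a b).
  rewrite -big_split; apply: eq_bigr => a _ /=.
  rewrite (bigID (fun b : 'I_n => (a < b)%N))/=; congr (_ + _).
  rewrite (bigD1 a) ?ltnn//= F0 add0r; apply: eq_bigl => b.
  by rewrite -leqNgt ltn_neqAle andbC.
rewrite mulr2n; congr (_ + _).
rewrite (exchange_big_dep predT)//=; apply: eq_bigr => a _.
by apply: eq_bigr => b _.
Qed.

(** Summing over all pairs of indices is what makes commutators computable;
    the terms are symmetric because both [w] and the products of distinct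
    generators change sign under the exchange of indices. *)
Lemma spin_conn_double (w : 'M[R]_n) : w^T = - w ->
  spin_conn w *+ 2 = \sum_a \sum_b
    (2^-1 * sgn R r a * sgn R r b * w a b)%:C *: (gam S a *m gam S b).
Proof.
move=> /matrixP skew.
have {}skew a b : w a b = - w b a by have := skew b a; rewrite !mxE.
rewrite -sum_lt_sym// => [a b|a].
  have [->//|ab] := eqVneq a b.
  rewrite (gam_anti S ab) scalerN -scaleNr -raddfN; congr (_%:C *: _).
  by rewrite (skew a b); ring.
suff -> : w a a = 0 by rewrite mulr0 raddf0 scale0r.
by apply/eqP; rewrite -[_ == 0](mulrn_eq0 (w a a) 2) mulr2n {1}skew addNr.
Qed.

(** Under the isomorphism of so(n, r) with the Lie algebra of the spin group,
    the commutator with a vector is the action of the skew matrix on it. It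
    follows from the commutator of a product of two generators with a third
    one, [comm] below. *)
Lemma spin_conn_gam (w : 'M[R]_n) (c : 'I_n) : w^T = - w ->
  spin_conn w *m gam S c - gam S c *m spin_conn w =
  clifford S (row c (w *m sgnmx R n r)).
Proof.
move=> wT; have /matrixP skew := wT.
have {}skew a b : w a b = - w b a by have := skew b a; rewrite !mxE.
pose G := gam S; pose k a b : R[i] := (2^-1 * sgn R r a * sgn R r b * w a b)%:C.
pose s (d : 'I_n) : R[i] := (sgn R r d)%:C.
have kskew a b : k a b = - k b a.
  by rewrite /k (skew a b) -raddfN; congr (_%:C); ring.
have comm a b : G a *m G b *m G c - G c *m (G a *m G b) =
   (if b == c then - 2 * s c else 0) *: G a -
   (if a == c then - 2 * s c else 0) *: G b.
  have cl a' b' : G a' *m G b' + G b' *m G a' =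
      (if a' == b' then - 2 * s b' else 0)%:M.
    rewrite /G gam_clifford; case: eqP => [->|]; last by rewrite !raddf0.
    by rewrite rmorphM rmorphN rmorph_nat.
  transitivity (G a *m (G b *m G c + G c *m G b) - (G a *m G c + G c *m G a) *m G b).
    by rewrite mulmxDr mulmxDl !mulmxA addrKA.
  by rewrite !cl mul_mx_scalar mul_scalar_mx.
apply: mulr2_inj.
have -> : (spin_conn w *m G c - G c *m spin_conn w) *+ 2 =
    (spin_conn w *+ 2) *m G c - G c *m (spin_conn w *+ 2).
  by rewrite mulrnBl !mulr2n mulmxDl mulmxDr.
rewrite spin_conn_double// mulmx_suml mulmx_sumr -sumrB.
transitivity (\sum_a ((\sum_b k a b *: ((if b == c then - 2 * s c else 0) *: G a)) -
    \sum_b k a b *: ((if a == c then - 2 * s c else 0) *: G b))).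
  apply: eq_bigr => a _; rewrite mulmx_suml mulmx_sumr -!sumrB.
  apply: eq_bigr => b _.
  by rewrite -scalemxAl -scalemxAr -!scalerBr -comm.
rewrite sumrB.
have -> : \sum_a \sum_b k a b *: ((if b == c then - 2 * s c else 0) *: G a) =
    \sum_a (k a c * (- 2 * s c)) *: G a.
  apply: eq_bigr => a _; rewrite (bigD1 c)//= big1 => [|b /negPf ->].
    by rewrite eqxx addr0 scalerA.
  by rewrite scale0r scaler0.
have -> : \sum_a \sum_b k a b *: ((if a == c then - 2 * s c else 0) *: G b) =
    \sum_a (k c a * (- 2 * s c)) *: G a.
  rewrite (bigD1 c)//= [X in _ + X]big1 => [|a /negPf ->].
    by rewrite eqxx addr0; apply: eq_bigr => b _; rewrite scalerA.
  by rewrite big1// => b _; rewrite scale0r scaler0.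
rewrite -sumrB /clifford -sumrMnl; apply: eq_bigr => a _.
rewrite -scalerBl scalerMnl; congr (_ *: _).
rewrite kskew mxE mulmx_sgnmx /k /s -[in RHS]raddfMn.
have -> : -2 = (-2)%:C :> R[i] by rewrite rmorphN rmorph_nat.
rewrite -raddfN -!rmorphM -raddfB; congr (_%:C).
have ss := sgn_sqr R r c.
transitivity (2 * (sgn R r c * sgn R r c) * (sgn R r a * w c a)); first by field.
by rewrite ss; ring.
Qed.

Lemma spin_conn_clifford (w : 'M[R]_n) (W : V) : w^T = - w ->
  spin_conn w *m clifford S W - clifford S W *m spin_conn w =
  clifford S (W *m w *m sgnmx R n r).
Proof.
move=> skew; rewrite -mulmxA [in RHS]mulmx_sum_row clifford_sum.
rewrite [clifford S W]/clifford mulmx_sumr mulmx_suml -sumrB.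
apply: eq_bigr => c _.
by rewrite -scalemxAr -scalemxAl -scalerBr cliffordZ spin_conn_gam.
Qed.

End SpinConnection.

(** * The real product on spinors *)

Section SpinorProduct.
Local Open Scope complex_scope.
Variables (R : realType) (n r : nat) (S : spinor_module R n r).
Local Notation N := (2 ^ n./2)%N.
Local Notation V := 'rV[R]_n.
Implicit Types (v w : V) (phi psi : 'cV[R[i]]_N) (k : R).

Lemma rprodDl phi phi' psi :
  rprod S (phi + phi') psi = rprod S phi psi + rprod S phi' psi.
Proof. by rewrite /rprod /hprod raddfD !mulmxDl mxE cReD. Qed.

Lemma rprodZl k phi psi : rprod S (k%:C *: phi) psi = k * rprod S phi psi.
Proof.
rewrite /rprod /hprod linearZ /= -!scalemxAl mxE.
by rewrite cReM /= mul0r subr0.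
Qed.

Lemma rprodNl phi psi : rprod S (- phi) psi = - rprod S phi psi.
Proof. by rewrite -scaleN1r -[-1](rmorphN1 (real_complex R)) rprodZl mulN1r. Qed.

Lemma rprodC phi psi : rprod S phi psi = rprod S psi phi.
Proof. by rewrite /rprod herm_hermitian; case: (hprod _ _ _). Qed.

Lemma rprodZr k phi psi : rprod S phi (k%:C *: psi) = k * rprod S phi psi.
Proof. by rewrite rprodC rprodZl rprodC. Qed.

Lemma rprod_suml (I : Type) (s : seq I) (P : pred I) F psi :
  rprod S (\sum_(i <- s | P i) F i) psi =
  \sum_(i <- s | P i) rprod S (F i) psi.
Proof.
apply: (big_morph (rprod S ^~ psi)) => [x y|]; first exact: rprodDl.
rewrite -[0](scale0r (0 : 'cV[R[i]]_N)) -[0](rmorph0 (real_complex R)).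
by rewrite rprodZl mul0r.
Qed.

Lemma rprod_gam (a : 'I_n) phi psi :
  rprod S (gam S a *m phi) psi = - (-1) ^+ r * rprod S phi (gam S a *m psi).
Proof.
have /eqP := gam_skew S a phi psi; rewrite addr_eq0 => /eqP h.
rewrite /rprod h -[-1 in LHS](rmorphN1 (real_complex R)) -rmorphXn /=.
by rewrite -mulNr -raddfN cReM /= mul0r subr0.
Qed.

Lemma rprod_clifford w phi psi : rprod S (clifford S w *m phi) psi =
  - (-1) ^+ r * rprod S phi (clifford S w *m psi).
Proof.
rewrite /clifford !mulmx_suml rprod_suml [in RHS]rprodC rprod_suml mulr_sumr.
apply: eq_bigr => a _; rewrite -!scalemxAl !rprodZl rprod_gam mulrCA.
by rewrite [rprod S (gam S a *m psi) phi]rprodC.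
Qed.

(** By skewness and symmetry of the real product, both orders of the two
    generators give the same value, while they anticommute. *)
Lemma rprod_gam2 (a b : 'I_n) phi : a != b ->
  rprod S (gam S a *m gam S b *m phi) phi = 0.
Proof.
move=> ab; have E : rprod S (gam S a *m gam S b *m phi) phi =
    rprod S (gam S b *m gam S a *m phi) phi.
  by rewrite -!mulmxA rprod_gam [RHS]rprod_gam rprodC.
have := congr1 (fun M => rprod S (M *m phi) phi) (gam_anti S ab).
rewrite /= mulNmx rprodNl -E => /eqP.
by rewrite -addr_eq0 -mulr2n mulrn_eq0 => /eqP.
Qed.

Lemma rprod_spin_conn (w : 'M[R]_n) phi : rprod S (spin_conn S w *m phi) phi = 0.
Proof.
rewrite /spin_conn mulmx_suml rprod_suml big1// => a _.
rewrite mulmx_suml rprod_suml big1// => b ab.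
by rewrite -scalemxAl rprodZl rprod_gam2 ?mulr0// neq_ltn ab.
Qed.

Lemma clifford_anticomm v w :
  clifford S v *m clifford S w + clifford S w *m clifford S v =
  (-2 * (v *m sgnmx R n r *m w^T) 0 0)%:C%:M.
Proof.
transitivity (\sum_a \sum_b (v 0 a * w 0 b)%:C *:
    (gam S a *m gam S b + gam S b *m gam S a)).
  rewrite /clifford mulmx_suml mulmx_sumr -big_split; apply: eq_bigr => a _ /=.
  rewrite mulmx_sumr mulmx_suml -big_split; apply: eq_bigr => b _ /=.
  by rewrite -!scalemxAl -!scalemxAr !scalerA scalerDr -!rmorphM [w 0 b * _]mulrC.
rewrite mxE mulr_sumr !raddf_sum; apply: eq_bigr => a _.
rewrite (bigD1 a)//= big1 => [|b ab].
  rewrite gam_clifford eqxx addr0 mulmx_sgnmx mxE.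
  transitivity (((v 0 a * w 0 a)%:C * (- 2 * sgn R r a)%:C)%:M : 'M[R[i]]_N).
    exact: scale_scalar_mx.
  have -> : - 2 * (v 0 a * sgn R r a * w 0 a) = v 0 a * w 0 a * (- 2 * sgn R r a).
    by ring.
  by rewrite -rmorphM.
by rewrite gam_clifford eq_sym (negPf ab) !raddf0.
Qed.

(** The derivative of the constant function [rprod S (phi y) (phi y)] is twice
    this product. *)
Lemma rprod_pderiv (x : V) (m : 'I_n) (phi : V -> 'cV[R[i]]_N) (s : R) :
  is_pderiv_cmx m phi x (pderiv_cmx m phi x) ->
  (\forall y \near x, rprod S (phi y) (phi y) = s) ->
  rprod S (pderiv_cmx m phi x) (phi x) = 0.
Proof.
move=> hphi len.
have [h _] := is_pderiv_cmx_mulmx (is_pderiv_cmx_mulmx (is_pderiv_cmx_tr hphi)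
  (is_pderiv_cmx_cst m (herm S) x)) (is_pderiv_cmx_conj hphi) 0 0.
have := is_pderiv_val h; rewrite mulmx0 addr0 mxE cReD.
rewrite -![complex.Re _]/(rprod S _ _).
rewrite [rprod S (phi x) _]rprodC.
rewrite -/(pderiv m (fun y => rprod S (phi y) (phi y)) x).
have -> : pderiv m (fun y => rprod S (phi y) (phi y)) x =
    pderiv m (fun=> s) x.
  by apply: near_eq_derive.
rewrite /pderiv derive_cst.
by move/esym/eqP; rewrite -mulr2n mulrn_eq0 => /eqP.
Qed.

End SpinorProduct.

(** * The spinor derivative in an orthonormal frame *)

Section LocalFrame.
Local Open Scope complex_scope.
Local Open Scope classical_set_scope.
Variables (R : realType) (n r : nat) (S : spinor_module R n r).
Local Notation N := (2 ^ n./2)%N.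
Local Notation V := 'rV[R]_n.
Variables (U : set V) (g E : V -> 'M[R]_n).
Hypotheses (oU : open U) (g_smooth : mx_smooth_on U g).
Hypothesis g_sym : forall x, U x -> (g x)^T = g x.
Hypothesis E_smooth : mx_smooth_on U E.
Hypothesis E_orth : forall x, U x -> E x *m g x *m (E x)^T = sgnmx R n r.
Implicit Types (m : 'I_n) (x v w : V) (phi : V -> 'cV[R[i]]_N).
Local Notation sg := (sgnmx R n r).

Lemma frame_inverse x : U x ->
  E x \in unitmx /\ invmx (E x) = g x *m (E x)^T *m sg.
Proof.
by move=> Ux; apply: invmx_right; rewrite !mulmxA E_orth// sgnmxK.
Qed.

(** Writing the inverse of the metric with the frame exhibits its entries, and
    those of gradients, as differentiable functions, without determinants. *)
Lemma metric_inverse x : U x ->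
  g x \in unitmx /\ invmx (g x) = (E x)^T *m sg *m E x.
Proof.
move=> Ux; have [uE iE] := frame_inverse Ux; apply: invmx_right.
by rewrite !mulmxA -iE mulVmx.
Qed.

Let g_unit x (Ux : U x) : g x \in unitmx := (metric_inverse Ux).1.

Lemma grad_derivable (u : V -> R) m x : smooth_on U u -> U x ->
  is_pderiv_mx m (grad g u) x (pderiv_mx m (grad g u) x).
Proof.
move=> su Ux; have hE := smooth_is_pderiv_mx m E_smooth Ux.
have h := is_pderiv_mulmx (pderiv_differential su m Ux)
  (is_pderiv_mulmx (is_pderiv_mulmx (is_pderiv_mx_tr hE)
    (is_pderiv_mx_cst m sg x)) hE).
have ng : \forall y \near x,
    differential u y *m ((E y)^T *m sg *m E y) = grad g u y.
  apply: (near_open oU Ux) => y Uy.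
  by rewrite /grad (metric_inverse Uy).2.
by have {}h := is_pderiv_mx_near ng h; rewrite (is_pderiv_mx_val h).
Qed.

(** Connection matrix of the frame: its entries are
    g(nabla_m e_a, e_b). *)
Definition omega m x : 'M[R]_n :=
  (pderiv_mx m E x + E x *m conn g m x) *m g x *m (E x)^T.

(** Differentiating the orthonormality relation, whose right-hand side is
    constant. *)
Lemma omega_skew m x : U x -> (omega m x)^T = - omega m x.
Proof.
move=> Ux; have hE := smooth_is_pderiv_mx m E_smooth Ux.
have hg := smooth_is_pderiv_mx m g_smooth Ux.
have := is_pderiv_mx_val (is_pderiv_mx_near (near_open oU Ux E_orth)
  (is_pderiv_mulmx (is_pderiv_mulmx hE hg) (is_pderiv_mx_tr hE))).
rewrite (is_pderiv_mx_val (is_pderiv_mx_cst m sg x)).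
rewrite (conn_metric oU g_smooth g_sym g_unit m Ux) => h.
apply/eqP; rewrite -addr_eq0; apply/eqP; rewrite h /omega.
rewrite !(trmx_mul, raddfD) /= trmxK g_sym//.
rewrite !(mulmxDl, mulmxDr, mulmxA) addrC -!addrA; congr (_ + (_ + _)).
by rewrite addrC trmx_mul mulmxA.
Qed.

Lemma spin_nablaE v phi x : spin_nabla S g E v phi x =
  \sum_m (v 0 m)%:C *: (pderiv_cmx m phi x + spin_conn S (omega m x) *m phi x).
Proof.
under [RHS]eq_bigr do rewrite scalerDr.
rewrite big_split /=; congr (_ + _).
under [RHS]eq_bigr do rewrite scalemxAl.
rewrite -mulmx_suml -spin_conn_sum /spin_conn mulmx_suml.
apply: eq_bigr => a _; rewrite mulmx_suml; apply: eq_bigr => b _.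
rewrite -scalemxAl; congr ((_ * _)%:C *: _).
rewrite /ip nablaE !mulmx_suml summxE summxE; apply: eq_bigr => m _.
rewrite -!scalemxAl mxE [RHS]mxE; congr (_ * _).
have -> : pderiv_mx m (fun y => row a (E y)) x = row a (pderiv_mx m E x).
  apply/matrixP => i j; rewrite !mxE; congr pderiv.
  by apply/funext => y; rewrite mxE.
rewrite -row_mul -raddfD /= -!row_mul -[RHS]/(omega m x a b) /omega.
by rewrite !mxE; apply: eq_bigr => k _; rewrite !mxE.
Qed.

Lemma spin_nabla_near v phi phi' x : (\forall y \near x, phi y = phi' y) ->
  spin_nabla S g E v phi x = spin_nabla S g E v phi' x.
Proof.
move=> h; rewrite !spin_nablaE (nbhs_singleton h).
by apply: eq_bigr => m _; rewrite (pderiv_cmx_near m h).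
Qed.

Lemma spin_nabla_suml (I : Type) (s : seq I) (c : I -> R) (w : I -> V) phi x :
  spin_nabla S g E (\sum_(i <- s) c i *: w i) phi x =
  \sum_(i <- s) (c i)%:C *: spin_nabla S g E (w i) phi x.
Proof.
rewrite spin_nablaE; under [RHS]eq_bigr do rewrite spin_nablaE scaler_sumr.
rewrite exchange_big; apply: eq_bigr => m _ /=.
under [RHS]eq_bigr do rewrite scalerA -rmorphM.
rewrite -scaler_suml -raddf_sum summxE; congr (_%:C *: _).
by apply: eq_bigr => i _; rewrite mxE.
Qed.

Lemma cmul_unfold x v : cmul S (E x) v = clifford S (v *m invmx (E x)).
Proof. by []. Qed.

Definition cderivable phi x :=
  forall m, is_pderiv_cmx m phi x (pderiv_cmx m phi x).

Lemma is_pderiv_clifford m (W : V -> V) x dW : is_pderiv_mx m W x dW ->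
  is_pderiv_cmx m (fun y => clifford S (W y)) x (clifford S dW).
Proof.
move=> hW i j.
have cE w : clifford S w i j =
    (map_mx (real_complex R) w *m (\col_a gam S a i j)) 0 0.
  by rewrite /clifford summxE mxE; apply: eq_bigr => a _; rewrite !mxE.
have := is_pderiv_cmx_mulmx (is_pderiv_cmx_real hW)
  (is_pderiv_cmx_cst m (\col_a gam S a i j) x) 0 0.
rewrite mulmx0 addr0 -cE /is_cpderiv => -[hr hi].
by split; under eq_fun do rewrite cE.
Qed.

(** With [X = W E], the derivative of [X] splits into that of the components
    [W] and the action of the connection matrix of the frame; the latter is the
    commutator of the spin connection with Clifford multiplication by
    [spin_conn_clifford]. *)
Lemma spin_nabla_cmul v (X : V -> V) phi x : U x ->
  (forall m, is_pderiv_mx m X x (pderiv_mx m X x)) -> cderivable phi x ->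
  spin_nabla S g E v (fun y => cmul S (E y) (X y) *m phi y) x =
  cmul S (E x) (nabla g v X x) *m phi x +
  cmul S (E x) (X x) *m spin_nabla S g E v phi x.
Proof.
move=> Ux hX hphi; have [uE iE] := frame_inverse Ux.
pose W y := X y *m (g y *m (E y)^T *m sg).
have XW y : U y -> cmul S (E y) (X y) = clifford S (W y).
  by move=> Uy; rewrite cmul_unfold (frame_inverse Uy).2.
rewrite (spin_nabla_near v (phi' := fun y => clifford S (W y) *m phi y));
  last by apply: (near_open oU Ux) => y Uy; rewrite XW.
rewrite !spin_nablaE XW// nablaE cmul_unfold
  [_ *m invmx _]mulmx_suml clifford_sum [X in _ = X + _]mulmx_suml
  [X in _ = _ + X]mulmx_sumr.
rewrite -big_split; apply: eq_bigr => m _ /=.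
rewrite -scalemxAl cliffordZ -scalemxAl -scalemxAr -scalerDr; congr (_ *: _).
have hE := smooth_is_pderiv_mx m E_smooth Ux.
have hg := smooth_is_pderiv_mx m g_smooth Ux.
have hW := is_pderiv_mulmx (hX m) (is_pderiv_mulmx (is_pderiv_mulmx hg
  (is_pderiv_mx_tr hE)) (is_pderiv_mx_cst m sg x)).
have {}hW : is_pderiv_mx m W x (pderiv_mx m W x).
  by rewrite (is_pderiv_mx_val hW).
have WE y : U y -> W y *m E y = X y.
  move=> Uy; have [uEy iEy] := frame_inverse Uy.
  by rewrite /W -iEy mulmxKV.
have dX := is_pderiv_mx_val (is_pderiv_mx_near (near_open oU Ux WE)
  (is_pderiv_mulmx hW hE)).
rewrite dX -(WE x Ux).
have -> : (pderiv_mx m W x *m E x + W x *m pderiv_mx m E x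
     + W x *m E x *m conn g m x) *m invmx (E x)
   = pderiv_mx m W x + W x *m omega m x *m sg.
  rewrite -addrA -[W x *m E x *m _]mulmxA -mulmxDr mulmxDl mulmxK//.
  by rewrite iE /omega !mulmxA.
rewrite (is_pderiv_cmx_val
  (is_pderiv_cmx_mulmx (is_pderiv_clifford hW) (hphi m))).
rewrite cliffordD mulmxDl mulmxDr -!addrA; congr (_ + _).
rewrite [RHS]addrCA; congr (_ + _); rewrite !mulmxA -mulmxDl; congr (_ *m _).
apply/eqP; rewrite -subr_eq; apply/eqP.
by rewrite spin_conn_clifford ?omega_skew// /omega !mulmxA.
Qed.

End LocalFrame.

(** * Clifford multiplication by tangent vectors *)

Section FrameClifford.
Local Open Scope complex_scope.
Local Open Scope classical_set_scope.
Variables (R : realType) (n r : nat) (S : spinor_module R n r).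
Local Notation N := (2 ^ n./2)%N.
Local Notation V := 'rV[R]_n.
Variables (U : set V) (g E : V -> 'M[R]_n).
Hypothesis g_sym : forall x, U x -> (g x)^T = g x.
Hypothesis E_orth : forall x, U x -> E x *m g x *m (E x)^T = sgnmx R n r.
Implicit Types (m : 'I_n) (x v w : V) (phi : 'cV[R[i]]_N) (k : R).

Lemma cmulZ x k v : cmul S (E x) (k *: v) = k%:C *: cmul S (E x) v.
Proof. by rewrite /cmul -scalemxAl cliffordZ. Qed.

Lemma rprod_cmul x v phi psi : rprod S (cmul S (E x) v *m phi) psi =
  - (-1) ^+ r * rprod S phi (cmul S (E x) v *m psi).
Proof. exact: rprod_clifford. Qed.

Lemma cmul_anticomm x v w : U x ->
  cmul S (E x) v *m cmul S (E x) w =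
  (- 2 * ip g x v w)%:C%:M - cmul S (E x) w *m cmul S (E x) v.
Proof.
move=> Ux; have [uE _] := frame_inverse E_orth Ux.
apply/eqP; rewrite -subr_eq opprK; apply/eqP.
rewrite /cmul clifford_anticomm -(E_orth Ux); congr (_ * _)%:C%:M.
rewrite trmx_mul !mulmxA mulmxKV// -[_ *m (E x)^T *m _]mulmxA.
by rewrite -[(E x)^T *m _]trmx_mul mulVmx// trmx1 mulmx1.
Qed.

Lemma cmul_sqr x v : U x ->
  cmul S (E x) v *m cmul S (E x) v = (- ip g x v v)%:C%:M.
Proof.
move=> Ux; have /eqP := cmul_anticomm v v Ux; rewrite -subr_eq opprK.
rewrite -mulr2n => /eqP h; apply: mulr2_inj; rewrite h.
have -> : - 2 * ip g x v v = (- ip g x v v) *+ 2 by ring.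
by rewrite !raddfMn.
Qed.

Lemma frame_coord x v a : U x ->
  (v *m invmx (E x)) 0 a = sgn R r a * ip g x (row a (E x)) v.
Proof.
move=> Ux; have [_ ->] := frame_inverse E_orth Ux.
rewrite !mulmxA mulmx_sgnmx mulrC (ip_sym g_sym _ _ Ux) /ip; congr (_ * _).
by rewrite !mxE; apply: eq_bigr => b _; rewrite !mxE.
Qed.

Lemma frame_expansion x v : U x ->
  v = \sum_a (sgn R r a * ip g x (row a (E x)) v) *: row a (E x).
Proof.
move=> Ux; have [uE _] := frame_inverse E_orth Ux.
rewrite -[LHS](mulmxKV uE) mulmx_sum_row; apply: eq_bigr => a _.
by rewrite frame_coord.
Qed.

Lemma cmul_expansion x v : U x ->
  cmul S (E x) v = \sum_a (sgn R r a * ip g x (row a (E x)) v)%:C *: gam S a.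
Proof. by move=> Ux; apply: eq_bigr => a _; rewrite frame_coord. Qed.

Lemma cmul_frame x a : U x -> cmul S (E x) (row a (E x)) = gam S a.
Proof.
move=> Ux; have [uE _] := frame_inverse E_orth Ux.
by rewrite /cmul -row_mul mulmxV// row1 clifford_delta.
Qed.

(** [clifford_trace] for the matrix of [A] in the frame, which is self-adjoint
    for the standard product because [A] is so for the metric. *)
Lemma cmul_trace x (A : 'M[R]_n) : U x -> (A *m g x)^T = A *m g x ->
  \sum_a (sgn R r a)%:C *: (gam S a *m cmul S (E x) (row a (E x) *m A)) =
  - (\tr A)%:C%:M.
Proof.
move=> Ux symA; have [uE iE] := frame_inverse E_orth Ux.
have -> : \tr A = \tr (E x *m A *m invmx (E x)).
  by rewrite mxtrace_mulC mulmxA mulVmx// mul1mx.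
rewrite -(clifford_trace S).
  by apply: eq_bigr => a _; rewrite /cmul -!row_mul.
have -> : E x *m A *m invmx (E x) *m sgnmx R n r = E x *m (A *m g x) *m (E x)^T.
  by rewrite iE -!mulmxA sgnmxK mulmx1.
by rewrite trmx_mul trmxK trmx_mul symA mulmxA.
Qed.

(** Exchanging the two vectors does not change the left-hand side, so only
    their anticommutator contributes. *)
Lemma rprod_cmul2 x v w phi : U x ->
  rprod S (cmul S (E x) v *m (cmul S (E x) w *m phi)) phi =
  - ip g x v w * rprod S phi phi.
Proof.
move=> Ux; have h : rprod S (cmul S (E x) v *m (cmul S (E x) w *m phi)) phi =
    rprod S (cmul S (E x) w *m (cmul S (E x) v *m phi)) phi.
  by rewrite rprod_cmul [RHS]rprod_cmul rprodC.
have := congr1 (fun A => rprod S (A *m phi) phi) (cmul_anticomm v w Ux).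
rewrite /= mulmxBl mul_scalar_mx rprodDl rprodNl rprodZl -!mulmxA -h.
move: (rprod S (cmul _ _ _ *m _) _) (rprod S phi phi) (ip _ _ _ _) => p q l {h} hp.
lra.
Qed.

(** The outer factors [v] are moved to both sides of the product, which reduces
    to [rprod_cmul2] for the spinor [v.phi] and for [phi]. *)
Lemma rprod_cmul4 x v w z phi : U x ->
  rprod S (cmul S (E x) v *m (cmul S (E x) w *m
    (cmul S (E x) z *m (cmul S (E x) v *m phi)))) phi =
  ip g x w z * ip g x v v * rprod S phi phi.
Proof.
move=> Ux; rewrite rprod_cmul rprod_cmul2//.
have := rprod_cmul2 v v phi Ux; rewrite rprod_cmul => h.
by rewrite mulrCA h; ring.
Qed.

Lemma cmul_sandwich x v w phi : U x ->
  cmul S (E x) v *m (cmul S (E x) w *m (cmul S (E x) v *m phi)) =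
  (ip g x v v)%:C *: (cmul S (E x) w *m phi)
  - (2 * ip g x v w)%:C *: (cmul S (E x) v *m phi).
Proof.
move=> Ux; rewrite mulmxA cmul_anticomm// mulmxBl mul_scalar_mx.
rewrite -[_ *m _ *m (_ *m phi)]mulmxA.
rewrite [cmul S (E x) v *m (_ *m phi)]mulmxA cmul_sqr// mul_scalar_mx -scalemxAr.
by rewrite addrC rmorphN scaleNr opprK mulNr rmorphN scaleNr.
Qed.

End FrameClifford.

(** * Weakly T-parallel spinors in a chart *)

Section WeaklyTParallel.
Local Open Scope complex_scope.
Local Open Scope classical_set_scope.
Variables (R : realType) (n r : nat) (S : spinor_module R n r).
Local Notation N := (2 ^ n./2)%N.
Local Notation V := 'rV[R]_n.
Variables (U : set V) (g E : V -> 'M[R]_n).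
Hypotheses (oU : open U) (g_smooth : mx_smooth_on U g).
Hypothesis g_sym : forall x, U x -> (g x)^T = g x.
Hypothesis E_smooth : mx_smooth_on U E.
Hypothesis E_orth : forall x, U x -> E x *m g x *m (E x)^T = sgnmx R n r.
Variables (u : V -> R) (b : V -> 'M[R]_n) (psi : V -> 'cV[R[i]]_N) (sigma : R).
Hypotheses (u_smooth : smooth_on U u) (psi_smooth : cmx_smooth_on U psi).
Hypothesis psi_length : forall x, U x -> rprod S (psi x) (psi x) = sigma.
Hypothesis sigma_sqr : sigma * sigma = 1.
Hypothesis b_sym : forall x X Y, U x ->
  ip g x X (Y *m b x) = ip g x (X *m b x) Y.
Hypothesis b_trace : forall x, U x -> \tr (b x) = n%:R.
Hypothesis psi_eq : forall x X, U x -> spin_nabla S g E X psi x =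
  - (4^-1 * du u x X)%:C *: psi x
  - (4^-1)%:C *: (cmul S (E x) (X *m b x) *m cmul S (E x) (grad g u x) *m psi x).
Implicit Types (m : 'I_n) (x v w : V).

Let kappa : R := (n%:R - 1) / 4.
Local Notation grd := (grad g u).
Local Notation c x := (cmul S (E x)).

Let g_unit x (Ux : U x) : g x \in unitmx := (metric_inverse E_orth Ux).1.

Let psi_derivable x (Ux : U x) : cderivable psi x :=
  fun m => smooth_is_pderiv_cmx m psi_smooth Ux.

Let du_ip x v (Ux : U x) : du u x v = ip g x v (grd x).
Proof. by rewrite (ip_grad g_sym g_unit u v Ux). Qed.

Let sigma_neq0 : sigma != 0.
Proof.
by apply: contra_eq_neq sigma_sqr => ->; rewrite mul0r eq_sym oner_eq0.
Qed.

(** Constancy of the length gives this for the partial derivatives of [psi],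
    and the spin connection is skew. *)
Lemma length_parallel x v : U x ->
  rprod S (spin_nabla S g E v psi x) (psi x) = 0.
Proof.
move=> Ux; rewrite spin_nablaE rprod_suml big1// => m _.
rewrite rprodZl rprodDl rprod_spin_conn addr0 (rprod_pderiv (s := sigma)) ?mulr0//.
  exact: psi_derivable.
exact: (near_open oU Ux).
Qed.

(** [length_parallel] with the derivative of [psi] replaced by its
    expression: the two terms are multiples of [sigma]. *)
Lemma ip_b_grad x v : U x ->
  ip g x (v *m b x) (grd x) = ip g x v (grd x).
Proof.
move=> Ux; have := length_parallel v Ux.
rewrite (psi_eq _ Ux) rprodDl rprodNl -rmorphN !rprodZl -mulmxA.
rewrite (rprod_cmul2 S E_orth _ _ _ Ux) (du_ip _ Ux) (psi_length Ux).
move=> h; apply: (mulIf sigma_neq0); lra.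
Qed.

Lemma b_grad x : U x -> grd x *m b x = grd x.
Proof.
move=> Ux; apply: (ip_inj g_unit Ux) => v.
by rewrite b_sym// ip_b_grad.
Qed.

Lemma nabla_grad_psi x : U x -> spin_nabla S g E (grd x) psi x = 0.
Proof.
move=> Ux; rewrite (psi_eq _ Ux) (b_grad Ux) (cmul_sqr S E_orth _ Ux) (du_ip _ Ux).
rewrite mul_scalar_mx scalerA -scaleNr -scalerDl -rmorphM -!rmorphN -rmorphD mulrN.
by rewrite opprK addNr scale0r.
Qed.

(** The two terms of the equation for [psi] contribute -1/4 and, through the
    trace n of [b], n/4. *)
Lemma dirac_psi x : U x ->
  Defs.dirac S g E psi x = kappa%:C *: (c x (grd x) *m psi x).
Proof.
move=> Ux.
have hb := ip_selfadjoint g_sym Ux (fun v w => b_sym v w Ux).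
rewrite /Defs.dirac; under eq_bigr => a _ do
  rewrite (psi_eq _ Ux) mulmxDr mulmxN -!scalemxAr -scaleNr scalerDr !mulmxA.
rewrite big_split /=.
have -> : \sum_a (sgn R r a)%:C *:
      (- (4^-1 * du u x (row a (E x)))%:C *: (gam S a *m psi x)) =
     - (4^-1)%:C *: (c x (grd x) *m psi x).
  rewrite (cmul_expansion S g_sym E_orth _ Ux) mulmx_suml scaler_sumr.
  apply: eq_bigr => a _; rewrite -scalemxAl !scalerA -!rmorphN -!rmorphM.
  by rewrite (du_ip _ Ux); congr (_%:C *: _); ring.
have -> : \sum_a (sgn R r a)%:C *: (- (4^-1)%:C *:
      (gam S a *m c x (row a (E x) *m b x) *m c x (grd x) *m psi x)) =
     (4^-1 * n%:R)%:C *: (c x (grd x) *m psi x).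
  transitivity (- (4^-1)%:C *: ((\sum_a (sgn R r a)%:C *:
      (gam S a *m c x (row a (E x) *m b x))) *m (c x (grd x) *m psi x))).
    rewrite mulmx_suml scaler_sumr; apply: eq_bigr => a _.
    by rewrite -scalemxAl !scalerA mulrC !mulmxA.
  rewrite (cmul_trace S E_orth Ux hb) b_trace// mulNmx mul_scalar_mx.
  by rewrite scalerN scaleNr opprK scalerA rmorphM.
rewrite -scalerDl -rmorphN -rmorphD; congr (_%:C *: _).
by rewrite /kappa; field.
Qed.

Lemma spin_nabla_dirac x v : U x ->
  spin_nabla S g E v (Defs.dirac S g E psi) x =
  kappa%:C *: (c x (v *m hess g u x) *m psi x
               + c x (grd x) *m spin_nabla S g E v psi x).
Proof.
move=> Ux; have hgrad m := grad_derivable oU E_smooth E_orth m u_smooth Ux.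
have hk m : is_pderiv_mx m (fun y => kappa *: grd y) x
    (pderiv_mx m (fun y => kappa *: grd y) x).
  by have h := is_pderiv_mxZ kappa (hgrad m); rewrite (is_pderiv_mx_val h).
rewrite (spin_nabla_near S g E v
  (phi' := fun y => c y (kappa *: grd y) *m psi y)).
  rewrite (spin_nabla_cmul S oU g_smooth g_sym E_smooth E_orth v Ux hk
    (psi_derivable Ux)).
  by rewrite nablaZ// cmulZ nabla_gradE cmulZ -!scalemxAl -scalerDr.
apply: (near_open oU Ux) => y Uy.
by rewrite (dirac_psi Uy) cmulZ -scalemxAl.
Qed.

Let hess_selfadjoint x (Ux : U x) : (hess g u x *m g x)^T = hess g u x *m g x :=
  hess_sym oU g_smooth g_sym g_unit u_smooth
    (fun m y => grad_derivable oU E_smooth E_orth m u_smooth) Ux.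

(** Moving the gradient in front of the frame vectors produces, besides the
    Hessian and [dirac psi], only the derivative of [psi] along the gradient,
    which vanishes. *)
Lemma dirac_sqr x : U x -> Defs.dirac S g E (Defs.dirac S g E psi) x =
  (kappa ^+ 2 * normsq_du g u x + kappa * laplacian g u x)%:C *: psi x.
Proof.
move=> Ux; have hs := hess_selfadjoint Ux.
rewrite [LHS]/Defs.dirac.
under eq_bigr => a _ do rewrite (spin_nabla_dirac _ Ux).
transitivity (kappa%:C *: ((\sum_a (sgn R r a)%:C *:
      (gam S a *m c x (row a (E x) *m hess g u x))) *m psi x
  + (- 2)%:C *: \sum_a (sgn R r a * ip g x (row a (E x)) (grd x))%:C *:
      spin_nabla S g E (row a (E x)) psi x
  - c x (grd x) *m Defs.dirac S g E psi x)).
  rewrite /Defs.dirac mulmx_suml mulmx_sumr scaler_sumr -big_split -sumrB.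
  rewrite scaler_sumr; apply: eq_bigr => a _ /=.
  rewrite -scalemxAr [LHS]scalerA [X in X *: _ = _]mulrC -[LHS]scalerA.
  congr (_ *: _); rewrite mulmxDr [gam S a *m (c x (grd x) *m _)]mulmxA.
  rewrite -[X in (X *m c x (grd x)) *m _](cmul_frame S E_orth a Ux).
  rewrite (cmul_anticomm S E_orth _ _ Ux) (cmul_frame S E_orth a Ux).
  rewrite mulmxBl mul_scalar_mx !scalerDr addrA -!scalemxAl -!mulmxA scalerN.
  by rewrite !scalerA -!rmorphM -scalemxAr mulrCA.
rewrite -(spin_nabla_suml S g E _
  (fun a => sgn R r a * ip g x (row a (E x)) (grd x)) (fun a => row a (E x))).
rewrite -(frame_expansion g_sym E_orth _ Ux) nabla_grad_psi// scaler0.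
rewrite addr0 (cmul_trace S E_orth Ux hs) (dirac_psi Ux) laplacianE -scalemxAr.
rewrite mulmxA (cmul_sqr S E_orth _ Ux) mulNmx !mul_scalar_mx scalerA.
rewrite -rmorphM -scaleNr -rmorphN -scalerBl -rmorphB scalerA -rmorphM.
by congr (_%:C *: _); rewrite /normsq_du; ring.
Qed.

Lemma mul_spin_nabla_psi (A : 'M[R[i]]_N) x Y : U x ->
  A *m spin_nabla S g E Y psi x = (- (4^-1 * ip g x Y (grd x)))%:C *: (A *m psi x)
  + (- 4^-1)%:C *: (A *m (c x (Y *m b x) *m (c x (grd x) *m psi x))).
Proof.
move=> Ux; rewrite (psi_eq _ Ux) mulmxBr -!scalemxAr -scaleNr -!rmorphN (du_ip _ Ux).
by rewrite -[c x (Y *m b x) *m _ *m _]mulmxA.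
Qed.

Lemma rprod_nabla_dirac x X Y : U x ->
  rprod S (c x X *m spin_nabla S g E Y (Defs.dirac S g E psi) x) (psi x) =
  kappa * (- ip g x X (Y *m hess g u x) + 4^-1 *
    (normsq_du g u x * ip g x X (Y *m b x)
     - ip g x X (grd x) * ip g x Y (grd x)))
  * sigma.
Proof.
move=> Ux; rewrite (spin_nabla_dirac _ Ux) -scalemxAr rprodZl mulmxDr rprodDl.
rewrite (rprod_cmul2 S E_orth _ _ _ Ux).
rewrite (mul_spin_nabla_psi _ _ Ux) mulmxDr -!scalemxAr rprodDl !rprodZl.
rewrite (cmul_sandwich S E_orth (grd x) (Y *m b x) (psi x) Ux).
rewrite mulmxBr -!scalemxAr rprodDl rprodNl !rprodZl.
rewrite !(rprod_cmul2 S E_orth X _ (psi x) Ux) (psi_length Ux).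
rewrite (ip_sym g_sym (grd x) _ Ux) (ip_b_grad _ Ux) /normsq_du.
by field.
Qed.

Lemma rprod_nabla_psi x X Y : U x ->
  (-1) ^+ r * rprod S (c x X *m spin_nabla S g E Y psi x)
    (Defs.dirac S g E psi x) =
  kappa * (4^-1 *
    (normsq_du g u x * ip g x X (Y *m b x)
     - ip g x X (grd x) * ip g x Y (grd x)))
  * sigma.
Proof.
(* Skewness moves the gradient of [dirac psi] in front of the left factor. *)
move=> Ux; rewrite (dirac_psi Ux) rprodZr mulrCA.
rewrite -[(-1) ^+ r * _]opprK -mulNr -rprod_cmul.
rewrite (mul_spin_nabla_psi _ _ Ux) mulmxDr -!scalemxAr rprodDl !rprodZl.
rewrite (rprod_cmul4 S E_orth (grd x) X (Y *m b x) (psi x) Ux)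
  (rprod_cmul2 S E_orth (grd x) X (psi x) Ux) (psi_length Ux).
rewrite (ip_sym g_sym (grd x) _ Ux) /normsq_du.
by field.
Qed.

Lemma energy_momentum_psi x X Y : U x ->
  energy_momentum_II S g E sigma psi x X Y =
  kappa * (normsq_du g u x * ip g x X (Y *m b x)
    - 2 * ip g x X (nabla g Y grd x) - du u x X * du u x Y).
Proof.
move=> Ux.
have split q1 q2 q3 q4 phi chi d1 d2 p1 p2 :
    rprod S q1 phi = d1 -> rprod S q2 phi = d2 ->
    (-1) ^+ r * rprod S q3 chi = p1 -> (-1) ^+ r * rprod S q4 chi = p2 ->
    sigma * rprod S (q1 + q2) phi + sigma * (-1) ^+ r * rprod S (q3 + q4) chi =
    sigma * (d1 + d2 + (p1 + p2)).
  by move=> <- <- <- <-; rewrite !rprodDl -mulrA -mulrDr -[in RHS]mulrDr.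
rewrite /energy_momentum_II (split _ _ _ _ _ _ _ _ _ _
  (rprod_nabla_dirac X Y Ux) (rprod_nabla_dirac Y X Ux)
  (rprod_nabla_psi X Y Ux) (rprod_nabla_psi Y X Ux)).
rewrite !(du_ip _ Ux) nabla_gradE.
have -> : ip g x Y (X *m b x) = ip g x X (Y *m b x).
  by rewrite (b_sym _ _ Ux) (ip_sym g_sym _ _ Ux).
have -> : ip g x Y (X *m hess g u x) = ip g x X (Y *m hess g u x).
  by rewrite (ip_mulmx_sym g_sym _ _ Ux (hess_selfadjoint Ux)).
transitivity (kappa * (normsq_du g u x * ip g x X (Y *m b x) -
    2 * ip g x X (Y *m hess g u x) - ip g x X (grd x) * ip g x Y (grd x))
    * (sigma * sigma)).
  by field.
by rewrite sigma_sqr mulr1.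
Qed.

End WeaklyTParallel.

Theorem theorem4p1 (R : realType) (n r : nat) (Hn : (3 <= n)%N)
  (M : manifold R n) (eta : metric M r)
  (S : spinor_module R n r) (Sp : spin_structure eta S)
  (psi : spinor_field Sp) (u : M -> R) (beta : endo_field M) (sigma : R)
  (Hpsi : weakly_T_parallel psi u beta sigma)
  (a c : R) (Ha : a != 0)
  (Hbeta : forall (i : chart M) (x X Y : 'rV[R]_n), chart_img i x ->
    let g := eta i in
    let ui := (u \o param i)%FUN in
    normsq_du g ui x * ip g x X (Y *m beta i x) =
    4 / (n%:R - 2) * (ricci g x X Y - 2^-1 * scal g x * ip g x X Y)
    - 2 * c / (a * (n%:R - 2)) * ip g x X Y
    + 2 * ip g x X (nabla g Y (grad g ui) x)
    + du ui x X * du ui x Y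
    + ((n%:R - 1) / 2 * normsq_du g ui x + 2 * laplacian g ui x)
      * ip g x X Y) :
  CL_Einstein_Dirac_II psi a c (4 * a * (n%:R - 2) / (n%:R - 1)) sigma
    (fun i x =>
       let ui := (u \o param i)%FUN in
       (n%:R - 1) ^+ 2 / 16 * normsq_du (eta i) ui x
       + (n%:R - 1) / 4 * laplacian (eta i) ui x).
Proof.
have [_ [sigma1 psi_length] [u_smooth _] [b_sym b_trace] psi_eq] := Hpsi.
have sigma_sqr : sigma * sigma = 1 by case: sigma1 => ->; rewrite ?mulrNN mulr1.
have n1 : n%:R - 1 != 0 :> R.
  by rewrite subr_eq0 -[1]/(1%:R) eqr_nat; case: (n) Hn => [|[|]].
have n2 : n%:R - 2 != 0 :> R.
  by rewrite subr_eq0 eqr_nat; case: (n) Hn => [|[|[|]]].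
move=> i x Ux g E.
have dirac2 := dirac_sqr
  (@chart_img_open _ _ M i) (@gram_smooth _ _ _ _ eta i)
  (@gram_sym _ _ _ _ eta i) (@frame_smooth _ _ _ _ _ _ Sp i)
  (@frame_orthonormal _ _ _ _ _ _ Sp i) (u_smooth i)
  (@spinor_smooth _ _ _ _ _ _ _ psi i) (psi_length i) sigma_sqr (b_sym i)
  (b_trace i) (psi_eq i) Ux.
have T X Y := energy_momentum_psi
  (@chart_img_open _ _ M i) (@gram_smooth _ _ _ _ eta i)
  (@gram_sym _ _ _ _ eta i) (@frame_smooth _ _ _ _ _ _ Sp i)
  (@frame_orthonormal _ _ _ _ _ _ Sp i) (u_smooth i)
  (@spinor_smooth _ _ _ _ _ _ _ psi i) (psi_length i) sigma_sqr (b_sym i)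
  (b_trace i) (psi_eq i) X Y Ux.
split.
  rewrite [LHS]dirac2; congr (_ *: _); congr (real_complex R _).
  by rewrite /=; field.
move=> X Y; rewrite T.
have := Hbeta i x X Y Ux.
rewrite /= => ->.
by field; rewrite n1 n2 Ha.
Qed.
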